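(* The notion of a locally f-projective quasi-coherent sheaf is Zariski local on the class of all schemes. That is: let $X$ be any scheme, with ring of sections $\mathcal R(u)$ over each open affine set $u \subseteq X$, let $X = \bigcup_{v \in V} v$ be any open affine covering of $X$, and let $\mathcal M$ be any quasi-coherent sheaf on $X$. If $\mathcal M(v)$ is an f-projective $\mathcal R(v)$-module for every $v \in V$, then $\mathcal M(u)$ is an f-projective $\mathcal R(u)$-module for every open affine set $u \subseteq X$.
   Context: Let $R$ be a commutative ring. For a class $\mathcal Q$ of $R$-modules, an $R$-module $M$ is $\mathcal Q$-Mittag-Leffler if for every family $(Q_i \mid i\in I)$ of elements of $\mathcal Q$ the canonical map $M \otimes_R \prod_{i\in I} Q_i \to \prod_{i \in I} M\otimes_R Q_i$, $m \otimes (q_i)_{i\in I} \mapsto (m\otimes q_i)_{i\in I}$, is injective. An $R$-module $M$ is f-projective if $M$ is flat and $\{R\}$-Mittag-Leffler (equivalently, each homomorphism from a finitely generated $R$-module to $M$ factorizes through a free module). A quasi-coherent sheaf $\mathcal M$ on a scheme $X$ with structure sheaf $\mathcal R$ is locally f-projective if for each open affine set $u$ of $X$, the $\mathcal R(u)$-module of sections $\mathcal M(u)$ is f-projective. *)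

(* Defs.v *)
From HB Require Import structures.
From mathcomp Require Import all_boot all_order all_algebra.
From mathcomp Require Import generic_quotient ring_quotient.
From mathcomp.multinomials Require Import freeg.
From mathcomp Require Import all_classical topology.

Set Implicit Arguments.
Unset Strict Implicit.
Unset Printing Implicit Defensive.

Import GRing.Theory.
Local Open Scope classical_set_scope.
Local Open Scope ring_scope.

(* Rings are [comPzRingType]: commutative, with the zero ring allowed, since
   it is the ring of sections over the empty open set. *)

(* M (x)_R N is the free abelian group on M * N modulo the subgroup generated
   by the bilinearity relations. Only the abelian group underlying the
   R-module M (x)_R N is constructed: it is used solely to say that canonical
   maps are injective. *)
Section Tensor.
Variables (R : comPzRingType) (M N : lmodType R).

Let F : zmodType := {freeg (M * N)%type / int}.
Let gen (m : M) (n : N) : F := << (m, n) >>.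

Inductive tensor_rel : F -> Prop :=
| tensor_rel0 : tensor_rel 0
| tensor_relB x y : tensor_rel x -> tensor_rel y -> tensor_rel (x - y)
| tensor_relDl m1 m2 n :
    tensor_rel (gen (m1 + m2) n - (gen m1 n + gen m2 n))
| tensor_relDr m n1 n2 :
    tensor_rel (gen m (n1 + n2) - (gen m n1 + gen m n2))
| tensor_relZ a m n : tensor_rel (gen (a *: m) n - gen m (a *: n)).

Definition tensor_relb : {pred F} := fun x => `[< tensor_rel x >].

Lemma tensor_relbP x : reflect (tensor_rel x) (x \in tensor_relb).
Proof. exact: asboolP. Qed.

Lemma tensor_relb_zmod_closed : zmod_closed tensor_relb.
Proof.
split=> [|x y /tensor_relbP hx /tensor_relbP hy]; apply/tensor_relbP.
  exact: tensor_rel0.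
exact: tensor_relB.
Qed.

HB.instance Definition _ :=
  GRing.isZmodClosed.Build F tensor_relb tensor_relb_zmod_closed.

Definition tensor : Type := Quotient.quot tensor_relb.
HB.instance Definition _ := GRing.Zmodule.on tensor.

Definition tens (m : M) (n : N) : tensor :=
  (\pi_(Quotient.quot tensor_relb) (gen m n))%qT.

Lemma tens_quot (x y : F) : tensor_rel (x - y) ->
  \pi_(Quotient.quot tensor_relb)%qT x = \pi_(Quotient.quot tensor_relb)%qT y.
Proof. by move=> /tensor_relbP; rewrite Quotient.idealrBE => /eqP. Qed.

Lemma tensDl m1 m2 n : tens (m1 + m2) n = tens m1 n + tens m2 n.
Proof. by rewrite /tens -[RHS]raddfD; apply/tens_quot/tensor_relDl. Qed.

Lemma tensDr m n1 n2 : tens m (n1 + n2) = tens m n1 + tens m n2.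
Proof. by rewrite /tens -[RHS]raddfD; apply/tens_quot/tensor_relDr. Qed.

Lemma tensZ a m n : tens (a *: m) n = tens m (a *: n).
Proof. exact/tens_quot/tensor_relZ. Qed.

Section Lift.
Variables (V : zmodType) (f : M -> N -> V).
Hypothesis fDl : forall m1 m2 n, f (m1 + m2) n = f m1 n + f m2 n.
Hypothesis fDr : forall m n1 n2, f m (n1 + n2) = f m n1 + f m n2.
Hypothesis fZ : forall a m n, f (a *: m) n = f m (a *: n).

(* [zmodule V] is V seen as a module over the integers *)
Definition free_lift : F -> V :=
  fglift (fun p : M * N => f p.1 p.2 : zmodule V).

Definition tensor_lift (t : tensor) : V :=
  free_lift (repr (t : Quotient.quot tensor_relb)).

Lemma free_liftB x y : free_lift (x - y) = free_lift x - free_lift y.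
Proof. exact: (@lift_is_additive _ _ (zmodule V)). Qed.

Lemma free_lift_gen m n : free_lift (gen m n) = f m n.
Proof. by rewrite /free_lift liftU /= scale1r. Qed.

Lemma free_liftD x y : free_lift (x + y) = free_lift x + free_lift y.
Proof.
have f0 : free_lift 0 = 0 by rewrite -[X in free_lift X](subrr 0) free_liftB subrr.
have fN z : free_lift (- z) = - free_lift z by rewrite -sub0r free_liftB f0 sub0r.
by rewrite -[X in x + X]opprK free_liftB fN opprK.
Qed.

Lemma free_lift_rel x : tensor_rel x -> free_lift x = 0.
Proof.
elim=> {x} [|x y _ hx _ hy|m1 m2 n|m n1 n2|a m n].
- by rewrite -[X in free_lift X](subrr 0) free_liftB subrr.
- by rewrite free_liftB hx hy subrr.
- by rewrite free_liftB free_liftD !free_lift_gen fDl subrr.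
- by rewrite free_liftB free_liftD !free_lift_gen fDr subrr.
- by rewrite free_liftB !free_lift_gen fZ subrr.
Qed.

Lemma tensor_lift_pi x :
  tensor_lift (\pi_(Quotient.quot tensor_relb) x)%qT = free_lift x.
Proof.
apply/eqP; rewrite -subr_eq0 -free_liftB; apply/eqP/free_lift_rel/tensor_relbP.
by rewrite Quotient.idealrBE reprK.
Qed.

Lemma tensor_lift_is_zmod_morphism : zmod_morphism tensor_lift.
Proof.
move=> s t; rewrite -[s]reprK -[t]reprK -[_ - _]raddfB.
by rewrite !tensor_lift_pi free_liftB.
Qed.

Lemma tensor_lift_tens m n : tensor_lift (tens m n) = f m n.
Proof. by rewrite tensor_lift_pi free_lift_gen. Qed.

End Lift.
End Tensor.

Section TensorMap.
Variables (R : comPzRingType) (M N N' : lmodType R) (g : {linear N -> N'}).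

(* id_M (x) g *)
Definition tensor_map : tensor M N -> tensor M N' :=
  tensor_lift (fun m n => tens m (g n)).

Let tensor_mapDl (m1 m2 : M) n :
  tens (m1 + m2) (g n) = tens m1 (g n) + tens m2 (g n).
Proof. exact: tensDl. Qed.
Let tensor_mapDr (m : M) n1 n2 :
  tens m (g (n1 + n2)) = tens m (g n1) + tens m (g n2).
Proof. by rewrite linearD tensDr. Qed.
Let tensor_mapZ a (m : M) n : tens (a *: m) (g n) = tens m (g (a *: n)).
Proof. by rewrite linearZ tensZ. Qed.

Lemma tensor_map_is_zmod_morphism : zmod_morphism tensor_map.
Proof. exact: tensor_lift_is_zmod_morphism. Qed.
HB.instance Definition _ := GRing.isZmodMorphism.Build
  (tensor M N) (tensor M N') tensor_map tensor_map_is_zmod_morphism.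

Lemma tensor_map_tens m n : tensor_map (tens m n) = tens m (g n).
Proof. exact: tensor_lift_tens. Qed.

End TensorMap.

Section ModuleProduct.
Variables (R : comPzRingType) (I : Type) (Q : I -> lmodType R).

Definition mprod : Type := forall i, Q i.
HB.instance Definition _ := gen_eqMixin mprod.
HB.instance Definition _ := gen_choiceMixin mprod.

Definition mprod_zero : mprod := fun=> 0.
Definition mprod_opp (x : mprod) : mprod := fun i => - x i.
Definition mprod_add (x y : mprod) : mprod := fun i => x i + y i.
Definition mprod_scale (a : R) (x : mprod) : mprod := fun i => a *: x i.

Fact mprod_addA : associative mprod_add.
Proof. by move=> x y z; apply/functional_extensionality_dep => i; apply: addrA. Qed.
Fact mprod_addC : commutative mprod_add.
Proof. by move=> x y; apply/functional_extensionality_dep => i; apply: addrC. Qed.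
Fact mprod_add0 : left_id mprod_zero mprod_add.
Proof. by move=> x; apply/functional_extensionality_dep => i; apply: add0r. Qed.
Fact mprod_addN : left_inverse mprod_zero mprod_opp mprod_add.
Proof. by move=> x; apply/functional_extensionality_dep => i; apply: addNr. Qed.
HB.instance Definition _ := GRing.isZmodule.Build mprod
  mprod_addA mprod_addC mprod_add0 mprod_addN.

Fact mprod_scaleA a b x :
  mprod_scale a (mprod_scale b x) = mprod_scale (a * b) x.
Proof. by apply/functional_extensionality_dep => i; apply: scalerA. Qed.
Fact mprod_scale1 : left_id 1 mprod_scale.
Proof. by move=> x; apply/functional_extensionality_dep => i; apply: scale1r. Qed.
Fact mprod_scaleDr : right_distributive mprod_scale +%R.
Proof. by move=> a x y; apply/functional_extensionality_dep => i; apply: scalerDr. Qed.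
Fact mprod_scaleDl x : {morph mprod_scale^~ x : a b / a + b}.
Proof. by move=> a b; apply/functional_extensionality_dep => i; apply: scalerDl. Qed.
HB.instance Definition _ := GRing.Zmodule_isLmodule.Build R mprod
  mprod_scaleA mprod_scale1 mprod_scaleDr mprod_scaleDl.

Definition mproj (i : I) (x : mprod) : Q i := x i.
Fact mproj_is_linear i : linear (mproj i).
Proof. by []. Qed.
HB.instance Definition _ i :=
  GRing.isLinear.Build R mprod (Q i) *:%R (mproj i) (mproj_is_linear i).

End ModuleProduct.

Section FProjective.
Variable R : comPzRingType.

(* The i-th component of m (x) (q_i)_i |-> (m (x) q_i)_i is id (x) proj_i. *)
Definition tensor_prod_map (M : lmodType R) (I : Type) (Q : I -> lmodType R)
    (t : tensor M (mprod Q)) : forall i, tensor M (Q i) :=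
  fun i => tensor_map (mproj i) t.

Lemma tensor_prod_map_tens (M : lmodType R) I (Q : I -> lmodType R) m q :
  tensor_prod_map (tens m q : tensor M (mprod Q)) = fun i => tens m (q i).
Proof.
by apply/functional_extensionality_dep => i; apply: tensor_map_tens.
Qed.

Definition mittag_leffler (C : lmodType R -> Prop) (M : lmodType R) : Prop :=
  forall (I : Type) (Q : I -> lmodType R), (forall i, C (Q i)) ->
    injective (@tensor_prod_map M I Q).

Definition flat (M : lmodType R) : Prop :=
  forall (N N' : lmodType R) (g : {linear N -> N'}),
    injective g -> injective (@tensor_map R M N N' g).

Definition f_projective (M : lmodType R) : Prop :=
  flat M /\ mittag_leffler (fun Q => Q = R^o) M.

End FProjective.

Definition prime_ideal (A : comPzRingType) (p : set A) : Prop :=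
  [/\ p 0, (forall x y, p x -> p y -> p (x + y)),
      (forall a x, p x -> p (a * x)), ~ p 1
    & forall x y, p (x * y) -> p x \/ p y].

Record Spec (A : comPzRingType) : Type := SpecPoint {
  spec_ideal : set A;
  spec_prime : prime_ideal spec_ideal
}.

Section Zariski.
Variable A : comPzRingType.

HB.instance Definition _ := gen_eqMixin (Spec A).
HB.instance Definition _ := gen_choiceMixin (Spec A).

Definition spec_zeros (E : set A) : set (Spec A) :=
  [set p | E `<=` spec_ideal p].
Definition basic_open (f : A) : set (Spec A) := ~` spec_zeros [set f].
Definition zariski_open : set (set (Spec A)) :=
  [set U | exists E, U = ~` spec_zeros E].

Fact zariski_openT : zariski_open setT.
Proof.
exists setT; rewrite -setC0; congr (~` _); apply/seteqP; split=> // p.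
by case: (spec_prime p) => _ _ _ p1 _ /(_ 1 I).
Qed.

Fact zariski_openI : setI_closed zariski_open.
Proof.
move=> _ _ [E ->] [F ->].
exists [set z | exists x y, [/\ E x, F y & z = x * y]].
rewrite -setCU; congr (~` _); apply/seteqP; split=> p /=.
  case: (spec_prime p) => _ _ pM _ _.
  by case=> h _ [x [y [Ex Fy ->]]]; [rewrite mulrC|]; apply/pM/h.
move=> h; case: (pselect (E `<=` spec_ideal p)) => [|nE]; [by left|right].
have [x [Ex npx]] : exists x, E x /\ ~ spec_ideal p x.
  by apply: contrapT => H; apply: nE => x Ex; apply: contrapT => npx; apply: H; exists x.
move=> y Fy; have /h : exists x0 y0, [/\ E x0, F y0 & x * y = x0 * y0] by exists x, y.
by case: (spec_prime p) => _ _ _ _ pM /pM[].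
Qed.

Fact zariski_open_bigU (I : Type) (U : I -> set (Spec A)) :
  (forall i, zariski_open (U i)) -> zariski_open (\bigcup_i U i).
Proof.
move=> /choice[E UE]; exists (\bigcup_i E i).
rewrite -[LHS]setCK setC_bigcup; congr (~` _); apply/seteqP; split=> p /=.
  move=> h x [i _ Eix]; have := h i Logic.I; rewrite UE setCK; exact.
move=> h i _; rewrite UE setCK => x Eix; apply: h; by exists i.
Qed.

HB.instance Definition _ := isOpenTopological.Build (Spec A)
  zariski_openT zariski_openI zariski_open_bigU.

End Zariski.

(* The ring map phi exhibits B as A_f: f becomes invertible, every element of B
   is a fraction phi a / phi f ^ n, and phi a = 0 only if a / 1 = 0 in A_f. *)
Definition is_ring_localization (A B : comPzRingType) (f : A)
    (phi : A -> B) : Prop :=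
  [/\ exists b, phi f * b = 1,
      forall b, exists a n, phi f ^+ n * b = phi a
    & forall a, phi a = 0 -> exists n, f ^+ n * a = 0].

(* The same for l : N -> L, additive and semilinear along phi : A -> B: it
   exhibits L as the module N_f. *)
Definition is_module_localization (A B : comPzRingType) (f : A)
    (phi : A -> B) (N : lmodType A) (L : lmodType B) (l : N -> L) : Prop :=
  [/\ bijective (fun y : L => phi f *: y),
      forall y, exists x n, phi f ^+ n *: y = l x
    & forall x, l x = 0 -> exists n, f ^+ n *: x = 0].

Record opens (X : topologicalType) : Type := Opens {
  opens_set :> set X;
  opens_open : open opens_set
}.

Definition opensI (X : topologicalType) (U V : opens X) : opens X :=
  Opens (openI (opens_open U) (opens_open V)).

Definition is_sheaf (X : topologicalType) (F : opens X -> Type)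
    (rho : forall U V : opens X, U `<=` V -> F V -> F U) : Prop :=
  forall (I : Type) (W : I -> opens X) (U : opens X)
    (WU : forall i, W i `<=` U) (s : forall i, F (W i)),
    U `<=` \bigcup_i W i ->
    (forall i j,
       rho (opensI (W i) (W j)) (W i) (@subIsetl X (W i) (W j)) (s i) =
       rho (opensI (W i) (W j)) (W j) (@subIsetr X (W i) (W j)) (s j)) ->
    exists! t : F U, forall i, rho (W i) U (WU i) t = s i.

Record ring_sheaf (X : topologicalType) : Type := RingSheaf {
  rsec :> opens X -> comPzRingType;
  rres : forall U V : opens X, U `<=` V -> {rmorphism rsec V -> rsec U};
  rres_id : forall (U : opens X) (UU : U `<=` U) s, rres UU s = s;
  rres_comp : forall (U V W : opens X)
    (UV : U `<=` V) (VW : V `<=` W) (UW : U `<=` W) s,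
    rres UV (rres VW s) = rres UW s;
  rsec_sheaf : is_sheaf (fun U V UV => @rres U V UV)
}.

Record module_sheaf (X : topologicalType) (O : ring_sheaf X) : Type :=
  ModuleSheaf {
  msec :> forall U : opens X, lmodType (O U);
  mres : forall (U V : opens X) (UV : U `<=` V),
    {linear msec V -> msec U | rres O UV \; *:%R};
  mres_id : forall (U : opens X) (UU : U `<=` U) s, mres UU s = s;
  mres_comp : forall (U V W : opens X)
    (UV : U `<=` V) (VW : V `<=` W) (UW : U `<=` W) s,
    mres UV (mres VW s) = mres UW s;
  msec_sheaf : is_sheaf (fun U V UV => @mres U V UV)
}.

(* psi and iota define an isomorphism from Spec A, with its structure sheaf,
   onto the open subspace U of (X, O). The structure sheaf of Spec A is the
   sheaf whose restriction to the basis of the D(f) is f |-> A_f; so an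
   isomorphism with it over the homeomorphism psi is determined by a ring map
   iota : A -> O(U) for which every A -> O(U) -> O(psi(D(f))) is the
   localization A -> A_f. *)
Record affine_chart (X : topologicalType) (O : ring_sheaf X) (U : opens X)
    (A : comPzRingType) (psi : Spec A -> X) (iota : {rmorphism A -> O U}) :
    Prop := AffineChart {
  chart_inj : injective psi;
  chart_continuous : continuous psi;
  chart_open : forall D : set (Spec A), open D -> open (psi @` D);
  chart_range : range psi = U;
  chart_loc : forall (f : A) (W : opens X) (WU : W `<=` U),
    W = psi @` basic_open f :> set X ->
    is_ring_localization f (rres O WU \o iota)
}.

Definition affine_open (X : topologicalType) (O : ring_sheaf X) (U : opens X) :
    Prop :=
  exists (A : comPzRingType) (psi : Spec A -> X) (iota : {rmorphism A -> O U}),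
    affine_chart psi iota.

Record scheme : Type := Scheme {
  scheme_space :> topologicalType;
  scheme_sheaf : ring_sheaf scheme_space;
  scheme_affine : forall x : scheme_space,
    exists2 U : opens scheme_space, (U : set _) x & affine_open scheme_sheaf U
}.

(* Every point has an affine open neighbourhood U ~ Spec A on which M is the
   sheaf associated with an A-module N, that is the sheaf whose sections over
   D(f) are N_f. *)
Definition quasi_coherent (X : scheme) (M : module_sheaf (scheme_sheaf X)) :
    Prop :=
  forall x : X, exists U : opens X, (U : set X) x /\
  exists (A : comPzRingType) (psi : Spec A -> X)
    (iota : {rmorphism A -> scheme_sheaf X U}),
    affine_chart psi iota /\
  exists (N : lmodType A) (nu : {linear N -> M U | iota \; *:%R}),
    forall (f : A) (W : opens X) (WU : W `<=` U),
      W = psi @` basic_open f :> set X ->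
      is_module_localization f (rres _ WU \o iota) (mres M WU \o nu).

Definition locally_f_projective (X : scheme)
    (M : module_sheaf (scheme_sheaf X)) : Prop :=
  forall u : opens X, affine_open (scheme_sheaf X) u -> f_projective (M u).

(* Main.v *)
Require Import Defs.
From HB Require Import structures.
From mathcomp Require Import all_boot all_order all_algebra.
From mathcomp.multinomials Require Import freeg.
From mathcomp Require Import all_classical topology.
From Stdlib Require List.

(** An R-module M is f-projective exactly when it satisfies a condition on
finite families, called [locally_dual] below: every finite family x in M can
be written x = C y, with C a matrix over R and y a finite family in M, so that
each linear relation r x = 0 is inherited by the coefficients, r C = 0. In
other words, the inclusion into M of the submodule generated by x factors
through a finite free module. For a flat and {R}-Mittag-Leffler M, the
condition comes from the tensor sum_i x_i (x) (r_i)_r, where r runs through all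
relations of x: its components vanish, so it is zero, and flatness explains
its vanishing by a matrix C ([f_projective_locally_dual]). The converse is
[locally_dual_f_projective].

This condition passes from M to a localization M_f by clearing denominators
([locally_dual_loc]). The descent from localizations M_f, with f in a finite
set generating the unit ideal, is the delicate point. A resolution of x over
R_f gives, after clearing denominators, f^P x = c z such that each r c vanishes
in R_f; but the power of f that kills r c depends on r, and the relations of x
need not be finitely generated. So the descent is made in two stages. A
single relation r raises no such problem, and treating relations one at a
time gives the equational criterion for M, hence flatness
([descent_equational], [equational_flat]). Flatness then handles all relations
at once: the tensor sum_i x_i (x) (r_i)_r vanishes in the tensor product of M
with a power of R_f, so that x = C y where all the r C vanish in R_f
([loc_resolves_modker]). Doing this for each f in turn, all the r C vanish in
each R_f, hence in R ([descent_locally_dual]).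

The geometric part supplies the localizations. Basic open sets are described
intrinsically, as the loci where a section is locally invertible; this makes
those of two affine open sets comparable, and the two share a
basic open set around each common point ([common_basic]). On every affine
open set U a quasi-coherent sheaf satisfies M(D(s)) = M(U)_s
([qcoh_affine]), by the usual gluing over a finite cover of U. For u affine
and x in u, choose a member v of the covering through x and a common basic open
set of u and v: the module of sections over it is a localization of M(v), so
it is f-projective, and it is also a localization of M(u). Finitely many of
these sets cover u, and M(u) is f-projective by descent. *)

Set Implicit Arguments.
Unset Strict Implicit.
Unset Printing Implicit Defensive.

Import GRing.Theory.
Local Open Scope classical_set_scope.
Local Open Scope ring_scope.

(** * Tensors as finite sums *)

Lemma sum_delta (R : pzRingType) (V : lmodType R) (J : finType) (i : J)
    (F : J -> V) :
  \sum_j (j == i)%:R *: F j = F i.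
Proof.
rewrite (bigD1 i) //= eqxx scale1r big1 ?addr0 // => j /negbTE ->.
by rewrite scale0r.
Qed.

Section TensorSums.
Variables (R : comPzRingType) (M N : lmodType R).
Implicit Types (m : M) (n : N).

Lemma tens0l n : tens (0 : M) n = 0.
Proof. by apply: (addrI (tens 0 n)); rewrite -tensDl !addr0. Qed.

Lemma tens0r m : tens m (0 : N) = 0.
Proof. by apply: (addrI (tens m 0)); rewrite -tensDr !addr0. Qed.

Lemma tensNl m n : tens (- m) n = - tens m n.
Proof. by apply: (addrI (tens m n)); rewrite -tensDl !subrr tens0l. Qed.

Lemma tens_suml (I : Type) (s : seq I) (P : pred I) (F : I -> M) n :
  tens (\sum_(i <- s | P i) F i) n = \sum_(i <- s | P i) tens (F i) n.
Proof.
by apply: (big_morph (fun m => tens m n)) => [x y|]; rewrite ?tensDl ?tens0l.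
Qed.

Lemma tens_sumr (I : Type) (s : seq I) (P : pred I) m (F : I -> N) :
  tens m (\sum_(i <- s | P i) F i) = \sum_(i <- s | P i) tens m (F i).
Proof.
by apply: (big_morph (tens m)) => [x y|]; rewrite ?tensDr ?tens0r.
Qed.

Lemma tensor_sum_seq (t : tensor M N) :
  exists w : seq (M * N), t = \sum_(p <- w) tens p.1 p.2.
Proof.
pose T (t : tensor M N) :=
  exists w : seq (M * N), t = \sum_(p <- w) tens p.1 p.2.
have T0 : T 0 by exists [::]; rewrite big_nil.
have TD x y : T x -> T y -> T (x + y).
  by move=> [v ->] [w ->]; exists (v ++ w); rewrite big_cat.
have TN x : T x -> T (- x).
  move=> [v ->]; exists [seq (- p.1, p.2) | p <- v]; rewrite big_map -sumrN.
  by apply: eq_bigr => p _; rewrite tensNl.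
rewrite -[t]reprK -[repr _]freeg_sumE raddf_sum.
apply: (big_ind T) => // -[m n] _; set c := coeff _ _.
have -> : << c *g (m, n) >> = << (m, n) >> *~ c :> {freeg (M * N) / int}.
  by rewrite freegU_mulz intz.
rewrite raddfMz; change (\pi_ _ _)%qT with (tens m n).
have TX k : T (tens m n *+ k).
  elim: k => [|k IH]; rewrite ?mulr0n // mulrS; apply: TD => //.
  by exists [:: (m, n)]; rewrite big_seq1.
by case: c => k; [exact: TX | apply: TN; exact: TX].
Qed.

Lemma tensor_sum (t : tensor M N) :
  exists (J : finType) (x : J -> M) (q : J -> N),
    t = \sum_j tens (x j) (q j).
Proof.
have [w ->] := tensor_sum_seq t.
exists 'I_(size w), (fun j => (tnth (in_tuple w) j).1),
  (fun j => (tnth (in_tuple w) j).2).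
by rewrite big_tnth.
Qed.

Lemma tensor_sum_rel (J : finType) (x : J -> M) (q : J -> N) :
  \sum_j tens (x j) (q j) = 0 ->
  tensor_rel (\sum_j << (x j, q j) >> : {freeg (M * N) / int}).
Proof.
move=> e; apply/tensor_relbP; rewrite -[X in X \in _]subr0 Quotient.idealrBE.
by apply/eqP; rewrite raddf_sum raddf0.
Qed.

Lemma free_lift_sum (V : zmodType) (f : M -> N -> V) (J : finType)
    (x : J -> M) (q : J -> N) :
  free_lift f (\sum_j << (x j, q j) >>) = \sum_j f (x j) (q j).
Proof.
have f0 : free_lift f 0 = 0.
  by rewrite -[X in free_lift _ X](subrr 0) free_liftB subrr.
rewrite (big_morph (free_lift f) (free_liftD f) f0).
by apply: eq_bigr => j _; rewrite free_lift_gen.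
Qed.

End TensorSums.

(** * Vanishing of tensors over a flat module *)

Section FlatVanish.
Variables (R : comPzRingType) (M Q : lmodType R) (J : finType) (q : J -> Q).

Definition lin_span_pred : {pred Q} :=
  fun v => `[< exists r : J -> R, v = \sum_j r j *: q j >].

Fact lin_span_submod_closed : submod_closed lin_span_pred.
Proof.
split.
  by apply/asboolP; exists (fun=> 0); rewrite big1 // => j; rewrite scale0r.
move=> a u v /asboolP[r ->] /asboolP[s ->]; apply/asboolP.
exists (fun j => a * r j + s j); rewrite scaler_sumr -big_split /=.
by apply: eq_bigr => j _; rewrite scalerDl scalerA.
Qed.

HB.instance Definition _ :=
  GRing.isSubmodClosed.Build R Q lin_span_pred lin_span_submod_closed.

Definition lin_span : Type := {v : Q | v \in lin_span_pred}.
HB.instance Definition _ := SubChoice.on lin_span.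
HB.instance Definition _ := [SubChoice_isSubLmodule of lin_span by <:].

Lemma lin_span_coef (v : lin_span) : {r : J -> R | val v = \sum_j r j *: q j}.
Proof. by case: v => v hv; apply: cid; exact: (asboolP _ hv). Qed.

Let sp (j : J) : q j \in lin_span_pred.
Proof.
by apply/asboolP; exists (fun i => (i == j)%:R); rewrite sum_delta.
Qed.

Definition lin_span_gen (j : J) : lin_span := Sub (q j) (sp j).

(** The columns of [C] are syzygies of [q], so that [sum_j v j (x) q j] is
visibly zero: it equals [sum_k y k (x) (sum_j C j k *: q j)]. *)
Definition syzygetic (v : J -> M) : Prop :=
  exists (K : finType) (C : J -> K -> R) (y : K -> M),
    (forall j, v j = \sum_k C j k *: y k) /\
    forall k, \sum_j C j k *: q j = 0.

Lemma syzygetic0 : syzygetic (fun=> 0).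
Proof.
exists 'I_0, (fun _ _ => 0), (fun _ => 0); split => [j|[]//].
by rewrite big_ord0.
Qed.

Lemma syzygeticB u v : syzygetic u -> syzygetic v -> syzygetic (fun j => u j - v j).
Proof.
move=> [K [C [y [uE C0]]]] [L [D [z [vE D0]]]].
exists (K + L)%type, (fun j k => match k with inl k => C j k | inr l => D j l end),
  (fun k => match k with inl k => y k | inr l => - z l end); split => [j|[k|l]//=].
rewrite big_sumType /= uE vE -sumrN; congr (_ + _).
by apply: eq_bigr => l _; rewrite scalerN.
Qed.

Lemma syzygetic1 (r : J -> R) m :
  \sum_j r j *: q j = 0 -> syzygetic (fun j => r j *: m).
Proof.
move=> r0; exists 'I_1, (fun j _ => r j), (fun=> m); split => // j.
by rewrite big_ord1.
Qed.

Let ext (u v : J -> M) : u =1 v -> syzygetic v -> syzygetic u.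
Proof. by move=> e; rewrite (_ : u = v) //; apply/functional_extensionality_dep. Qed.

(** Choosing coefficients on the generators [q] for each element of their span
does not give a bilinear map from [M * lin_span] to [J -> M], but it does so up
to syzygetic families. Hence each bilinearity relation goes to such a family,
with a single column in [C] for each failure of the choice to be linear. *)
Lemma syzygetic_rel z :
  @tensor_rel R M lin_span z ->
  syzygetic (free_lift (fun m v j => sval (lin_span_coef v) j *: m) z).
Proof.
pose c v := sval (lin_span_coef v); have cE v := svalP (lin_span_coef v).
elim=> {z} [|z1 z2 _ h1 _ h2|m1 m2 n|m n1 n2|a m n].
- rewrite -[X in free_lift _ X](subrr 0) free_liftB subrr; exact: syzygetic0.
- by rewrite free_liftB; apply: syzygeticB.
- rewrite free_liftB free_liftD !free_lift_gen.
  by apply: ext syzygetic0 => j; rewrite !fctE scalerDr; apply: subrr.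
- rewrite free_liftB free_liftD !free_lift_gen.
  apply: (@ext _ (fun j => (c (n1 + n2) j - (c n1 j + c n2 j)) *: m)).
    by move=> j; rewrite !fctE /= scalerBl scalerDl.
  apply: syzygetic1; under eq_bigr do rewrite scalerBl scalerDl.
  by rewrite sumrB big_split /= -!cE raddfD subrr.
- rewrite free_liftB !free_lift_gen.
  apply: (@ext _ (fun j => (c n j * a - c (a *: n) j) *: m)).
    by move=> j; rewrite !fctE /= scalerBl scalerA.
  apply: syzygetic1; under eq_bigr do rewrite scalerBl mulrC -scalerA.
  by rewrite sumrB -scaler_sumr -!cE [\val (_ *: _)]linearZ subrr.
Qed.

(** By flatness the tensor already vanishes over the submodule spanned by [q].
There the previous lemma applies, and the coefficients chosen for the
generators [q j] differ from the obvious ones by syzygies. *)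
Lemma flat_syzygetic (x : J -> M) :
  flat M -> \sum_j tens (x j) (q j) = 0 -> syzygetic x.
Proof.
move=> flatM x0.
have x0' : \sum_j tens (x j) (lin_span_gen j) = 0.
  apply: (flatM _ _ (val : {linear lin_span -> Q}) val_inj).
  rewrite raddf0 raddf_sum -[RHS]x0.
  by apply: eq_bigr => j _; rewrite /= tensor_map_tens.
have /syzygetic_rel := tensor_sum_rel x0'.
rewrite free_lift_sum => h.
set u := \sum_j _ in h.
have d j : syzygetic
    (fun i => (sval (lin_span_coef (lin_span_gen j)) i - (i == j)%:R) *: x j).
  apply: syzygetic1; under eq_bigr do rewrite scalerBl.
  by rewrite sumrB sum_delta -(svalP (lin_span_coef (lin_span_gen j))) subrr.
have S (v : J -> J -> M) : (forall j, syzygetic (v j)) ->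
    syzygetic (fun i => \sum_j v j i).
  move=> hv; suff : syzygetic (\sum_j v j) by apply: ext => i; rewrite fct_sumE.
  apply: (big_ind syzygetic) => // [|a b ha hb]; first exact: syzygetic0.
  apply: (@ext _ (fun j => a j - (0 - b j))); first by move=> j; rewrite sub0r opprK.
  by apply: syzygeticB => //; apply: syzygeticB => //; exact: syzygetic0.
apply: ext (syzygeticB h (S _ d)) => i.
rewrite /u fct_sumE; under [X in _ - X]eq_bigr do rewrite scalerBl.
rewrite sumrB opprB addrC subrK -[LHS]sum_delta.
by apply: eq_bigr => j _; rewrite eq_sym.
Qed.

End FlatVanish.

(** * Elementary form of f-projectivity *)

Record ideal (R : comPzRingType) (J : set R) : Prop := Ideal {
  ideal0 : J 0;
  idealD : forall a b, J a -> J b -> J (a + b);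
  idealM : forall a b, J b -> J (a * b)
}.

Lemma ideal_sum (R : comPzRingType) (J : set R) (I : Type) (s : seq I)
    (P : pred I) (F : I -> R) :
  ideal J -> (forall i, P i -> J (F i)) -> J (\sum_(i <- s | P i) F i).
Proof. by move=> [J0 JD _] h; apply: (big_ind J). Qed.

Section Resolution.
Variables (R : comPzRingType) (M : lmodType R).

(** The set [T r] says where the coefficients of the relation [r] pushed along
[C] should lie. It is allowed to depend on [r], so that one can ask for
vanishing of a single relation only, or for vanishing of all relations modulo
an ideal. *)
Definition resolves (I : finType) (x : I -> M) (T : (I -> R) -> set R) : Prop :=
  exists (K : finType) (C : I -> K -> R) (y : K -> M),
    (forall i, x i = \sum_k C i k *: y k) /\
    forall r, \sum_i r i *: x i = 0 -> forall k, T r (\sum_i r i * C i k).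

Lemma resolvesW (I : finType) (x : I -> M) (S T : (I -> R) -> set R) :
  (forall r, S r `<=` T r) -> resolves x S -> resolves x T.
Proof.
by move=> ST [K [C [y [xE h]]]]; exists K, C, y; split=> // r r0 k; apply/ST/h.
Qed.

Lemma resolves_self (I : finType) (x : I -> M) (T : (I -> R) -> set R) :
  (forall r, \sum_i r i *: x i = 0 -> forall i, T r (r i)) -> resolves x T.
Proof.
move=> h; exists I, (fun i k => (k == i)%:R), x; split=> [i|r r0 k].
  by rewrite sum_delta.
have -> : \sum_i r i * (k == i)%:R = r k; last exact: h.
rewrite -[RHS](sum_delta (V := R^o) k r); apply: eq_bigr => i _.
by rewrite eq_sym mulrC.
Qed.

(** If [r] is a relation of [x = C y], then [r C] is a relation of [y]. *)
Lemma relation_push (I K : finType) (C : I -> K -> R) (y : K -> M) (r : I -> R) :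
  \sum_k (\sum_i r i * C i k) *: y k = \sum_i r i *: (\sum_k C i k *: y k).
Proof.
under [RHS]eq_bigr do rewrite scaler_sumr.
rewrite exchange_big /=; apply: eq_bigr => k _; rewrite scaler_suml.
by apply: eq_bigr => i _; rewrite scalerA.
Qed.

(** Resolving first [x] by [y] and then [y] by [z] multiplies the matrices: a
relation [r] has final coefficients [(r C) D], which stay in the ideal [S r]
reached at the first step, and are in [T r] by the second one, where [r C] is
one of the relations of [y]. *)
Lemma resolves_comp (I : finType) (x : I -> M) (S T : (I -> R) -> set R) :
  (forall r, ideal (S r)) -> resolves x S ->
  (forall (K : finType) (C : I -> K -> R) (y : K -> M),
    resolves y (fun s a => forall r, s = (fun k => \sum_i r i * C i k) -> T r a)) ->
  resolves x (fun r a => S r a /\ T r a).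
Proof.
move=> idS [K [C [y [xE hS]]]] /(_ K C y)[L [D [z [yE hT]]]].
exists L, (fun i l => \sum_k C i k * D k l), z; split=> [i|r r0 l].
  rewrite xE; under eq_bigr do rewrite yE.
  by rewrite -relation_push.
have -> : \sum_i r i * (\sum_k C i k * D k l) =
    \sum_k (\sum_i r i * C i k) * D k l.
  under eq_bigr do rewrite mulr_sumr.
  rewrite exchange_big /=; apply: eq_bigr => k _; rewrite mulr_suml.
  by apply: eq_bigr => i _; rewrite mulrA.
split.
  by apply: (ideal_sum _ (idS r)) => k _; rewrite mulrC; apply/(idealM (idS r))/hS.
apply: (hT (fun k => \sum_i r i * C i k)) => //.
by rewrite relation_push -[RHS]r0; apply: eq_bigr => i _; rewrite xE.
Qed.

(** The equational criterion for flatness. *)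
Definition equational : Prop :=
  forall (I : finType) (x : I -> M) (r0 : I -> R),
    resolves x (fun r a => r = r0 -> a = 0).

(** When [x] spans a submodule [S] of [M], the columns of [C] are well-defined
linear forms on [S] because they kill the relations of [x]; together with [y]
they are a finite dual basis for [S] inside [M]. *)
Definition locally_dual : Prop :=
  forall (I : finType) (x : I -> M), resolves x (fun _ a => a = 0).

Lemma locally_dual_equational : locally_dual -> equational.
Proof. by move=> h I x r0; apply: resolvesW (h I x) => r a /= ->. Qed.

Lemma equational_seq (I : finType) (x : I -> M) (rs : seq (I -> R)) :
  equational -> resolves x (fun r a => List.In r rs -> a = 0).
Proof.
move=> eqM; elim: rs => [|r0 rs IH]; first exact: resolves_self.
suff : resolves x (fun r a => (List.In r rs -> a = 0) /\ (r = r0 -> a = 0)).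
  by apply: resolvesW => r a /= [h1 h2] [e|/h1//]; apply: h2.
apply: resolves_comp IH _ => [r|K C y].
  by split=> // [a b ha hb /[dup] /ha -> /hb ->|a b hb /hb ->];
    rewrite ?addr0 ?mulr0.
apply: resolvesW (eqM K y (fun k => \sum_i r0 i * C i k)) => s a /= h r sE rr0.
by apply: h; rewrite sE rr0.
Qed.

(** The equational criterion in terms of functions on [M]: a triple
[(a, m, n)] in [E] stands for the instance [c (a m + n) = a c m + c n] of
linearity. Coefficients can be chosen so that finitely many prescribed
instances hold, since each of them is one relation among finitely many
elements of [M]. *)
Lemma equational_functional (s : seq M) (E : seq (R * M * M)) :
  equational ->
  exists (K : finType) (c : M -> K -> R) (y : K -> M),
    (forall m, m \in s -> m = \sum_k c m k *: y k) /\
    forall e, e \in E -> forall k,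
      c (e.1.1 *: e.1.2 + e.2) k = e.1.1 * c e.1.2 k + c e.2 k.
Proof.
move=> eqM.
pose S := s ++ flatten [seq [:: e.1.1 *: e.1.2 + e.2; e.1.2; e.2] | e <- E].
pose x (j : seq_sub S) := val j.
pose d (m : M) (j : seq_sub S) : R := (val j == m)%:R.
pose rel (e : R * M * M) j :=
  d (e.1.1 *: e.1.2 + e.2) j - (e.1.1 * d e.1.2 j + d e.2 j).
pose rs := [seq rel e | e <- E].
have [K [C [y [xE h]]]] := equational_seq x rs eqM.
pose c m k := oapp (fun j : seq_sub S => C j k) 0 (insub m).
have dE m (mS : m \in S) (V : lmodType R) (F : seq_sub S -> V) :
    \sum_j d m j *: F j = F (SeqSub mS).
  exact: (sum_delta (SeqSub mS)).
have cE m (mS : m \in S) k : c m k = C (SeqSub mS) k.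
  by rewrite /c insubT.
exists K, c, y; split=> [m ms|e eE k].
  have mS : m \in S by rewrite mem_cat ms.
  by rewrite [LHS](xE (SeqSub mS) : m = _); apply: eq_bigr => k _; rewrite cE.
have inS m : m \in [:: e.1.1 *: e.1.2 + e.2; e.1.2; e.2] -> m \in S.
  move=> me; rewrite mem_cat; apply/orP; right; apply/flatten_mapP.
  by exists e.
have S0 := inS _ (mem_head _ _).
have S1 : e.1.2 \in S by apply: inS; rewrite !inE eqxx orbT.
have S2 : e.2 \in S by apply: inS; rewrite !inE eqxx !orbT.
have r0 : \sum_j rel e j *: x j = 0.
  under eq_bigr do rewrite scalerBl scalerDl -scalerA.
  by rewrite sumrB big_split /= -scaler_sumr !dE /= subrr.
have relE : List.In (rel e) rs.
  rewrite /rs; elim: (E) eE => //= e' E' IH; rewrite inE.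
  by move=> /orP[/eqP <-|/IH]; [left|right].
have := h (rel e) r0 k relE.
under eq_bigr do rewrite mulrBl mulrDl -mulrA.
rewrite sumrB big_split /= -mulr_sumr.
rewrite !(dE _ _ R^o (fun j => C j k)) !cE => /eqP.
by rewrite subr_eq0 => /eqP.
Qed.

(** A tensor vanishes because of finitely many instances of bilinearity in the
[M] variable, so it is also killed by maps which are bilinear only to that
extent. The triple [(1, 0, 0)] forces the value at [0] to be zero. *)
Lemma tensor_rel_witness (N : lmodType R) z :
  @tensor_rel R M N z ->
  exists E : seq (R * M * M), forall (V : zmodType) (f : M -> N -> V),
    (forall m n1 n2, f m (n1 + n2) = f m n1 + f m n2) ->
    (forall e, e \in E -> forall n,
       f (e.1.1 *: e.1.2 + e.2) n = f e.1.2 (e.1.1 *: n) + f e.2 n) ->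
    free_lift f z = 0.
Proof.
elim=> {z} [|z1 z2 _ [E1 h1] _ [E2 h2]|m1 m2 n|m n1 n2|a m n].
- exists [::] => V f _ _.
  by rewrite -[X in free_lift _ X](subrr 0) free_liftB subrr.
- exists (E1 ++ E2) => V f fD fE.
  by rewrite free_liftB h1 ?h2 ?subrr // => e eE; apply: fE;
    rewrite mem_cat eE ?orbT.
- exists [:: (1, m1, m2)] => V f fD /(_ _ (mem_head _ _) n) /=.
  by rewrite free_liftB free_liftD !free_lift_gen !scale1r => ->; rewrite subrr.
- by exists [::] => V f fD _; rewrite free_liftB free_liftD !free_lift_gen fD subrr.
- exists [:: (1, 0, 0); (a, m, 0)] => V f fD fE.
  have f0 : f 0 n = 0.
    have := fE (1, 0, 0) (mem_head _ _) n.
    by rewrite /= !scale1r addr0 -[LHS]addr0 => /addrI.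
  have := fE (a, m, 0); rewrite !inE eqxx orbT => /(_ isT n) /=.
  by rewrite free_liftB !free_lift_gen addr0 f0 addr0 => ->; rewrite subrr.
Qed.

(** If the image of [sum_j x j (x) q j] under an injective [g] vanishes, it does
so by finitely many instances of bilinearity. Take coefficients [c] that
respect these instances: then [sum_j c (x j) k *: g (q j) = 0] for all [k], so
[sum_j c (x j) k *: q j = 0] by injectivity, and the given tensor equals
[sum_k y k (x) (sum_j c (x j) k *: q j)]. *)
Lemma equational_flat : equational -> flat M.
Proof.
move=> eqM N N' g gI; apply: raddf_inj => t.
have [J [x [q ->]]] := tensor_sum t.
rewrite raddf_sum; under eq_bigr do rewrite /= tensor_map_tens.
move=> /tensor_sum_rel/tensor_rel_witness[E hE].
have [K [c [y [cy cE]]]] := equational_functional [seq x j | j <- enum J] E eqM.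
have q0 k : \sum_j c (x j) k *: q j = 0.
  apply: gI; rewrite raddf0 raddf_sum.
  rewrite -[RHS](hE N' (fun m n => c m k *: n)) ?free_lift_sum.
  - by apply: eq_bigr => j _; rewrite /= linearZ.
  - by move=> m n1 n2; rewrite scalerDr.
  - by move=> e /cE h n; rewrite h scalerDl scalerA [_ * e.1.1]mulrC.
rewrite (eq_bigr (fun j => \sum_k tens (y k) (c (x j) k *: q j))) => [|j _].
  by rewrite exchange_big /= big1 // => k _; rewrite -tens_sumr q0 tens0r.
rewrite [X in tens X _]cy; last by rewrite map_f ?mem_enum.
by rewrite tens_suml; apply: eq_bigr => k _; rewrite tensZ.
Qed.

Lemma mprod_sumE (I : Type) (Q : I -> lmodType R) (J : Type) (s : seq J)
    (F : J -> mprod Q) i :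
  (\sum_(j <- s) F j) i = \sum_(j <- s) F j i.
Proof. exact: (raddf_sum (mproj i)). Qed.

(** The product of copies of [R] used here is indexed by all the relations of
[x]; the [i]-th element of it collects the [i]-th coefficients. *)
Lemma f_projective_locally_dual : f_projective M -> locally_dual.
Proof.
move=> [flatM mlM] I x.
pose Rel := {r : I -> R | \sum_i r i *: x i = 0}.
pose q i : mprod (fun _ : Rel => R^o) := fun r => sval r i.
have t0 : \sum_i tens (x i) (q i) = 0.
  apply: (mlM Rel (fun=> R^o)) => //; apply/functional_extensionality_dep => r.
  rewrite /tensor_prod_map raddf0 raddf_sum.
  transitivity (tens (\sum_i sval r i *: x i) (1 : R^o)); last first.
    by rewrite (svalP r) tens0l.
  rewrite tens_suml; apply: eq_bigr => i _; rewrite /= tensor_map_tens tensZ.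
  by congr (tens _ _); rewrite -[LHS]mulr1.
have [K [C [y [xE C0]]]] := flat_syzygetic flatM t0.
exists K, C, y; split=> // r r0 k.
have := congr1 (fun f => f (exist _ r r0)) (C0 k); rewrite mprod_sumE => h.
by rewrite -[RHS]h; apply: eq_bigr => i _; rewrite mulrC.
Qed.

(** If all components of [sum_j x j (x) q j] are zero, then each coordinate of
[q] is a relation of [x]. A resolution [x = C y] kills all of these at the same
time, so [sum_j C j k *: q j] is zero in the product. *)
Lemma locally_dual_f_projective : locally_dual -> f_projective M.
Proof.
move=> ldM; split; first exact/equational_flat/locally_dual_equational.
move=> I Q QR; have {QR} -> : Q = fun=> R^o by apply/functional_extensionality_dep.
move=> t t' tt'; apply/eqP; rewrite -subr_eq0; apply/eqP.
have {tt'} : forall i, tensor_map (mproj i) (t - t') = 0.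
  by move=> i; rewrite raddfB /= [tensor_map _ t](congr1 (fun f => f i) tt') subrr.
have [J [x [q ->]]] := tensor_sum (t - t') => h.
have [K [C [y [xE C0]]]] := ldM J x.
have r0 i : \sum_j (q j i : R) *: x j = 0.
  pose ev (m : M) (a : R^o) := (a : R) *: m.
  have evDl m1 m2 n : ev (m1 + m2) n = ev m1 n + ev m2 n by exact: scalerDr.
  have evDr m n1 n2 : ev m (n1 + n2) = ev m n1 + ev m n2 by exact: scalerDl.
  have evZ a m n : ev (a *: m) n = ev m (a *: n).
    by rewrite /ev scalerA mulrC.
  pose L := tensor_lift ev.
  have LB : {morph L : s t / s - t} := tensor_lift_is_zmod_morphism evDl evDr evZ.
  have L0 : L 0 = 0 by rewrite -[X in L X](subrr 0) LB subrr.
  have LD : {morph L : s t / s + t}.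
    by move=> s u; rewrite -[u in LHS]opprK LB -[- u]sub0r LB L0 sub0r opprK.
  have := congr1 L (h i); rewrite L0 raddf_sum (big_morph L LD L0) => Lh.
  rewrite -[RHS]Lh.
  by apply: eq_bigr => j _; rewrite /= tensor_map_tens /L tensor_lift_tens.
rewrite (eq_bigr (fun j => \sum_k tens (y k) (C j k *: q j))) => [|j _].
  rewrite exchange_big /= big1 // => k _.
  rewrite -tens_sumr [X in tens _ X](_ : _ = 0) ?tens0r //.
  apply/functional_extensionality_dep => i; rewrite mprod_sumE.
  rewrite -[RHS](C0 (fun j => q j i) (r0 i) k).
  by apply: eq_bigr => j _; rewrite [RHS]mulrC.
by rewrite xE tens_suml; apply: eq_bigr => k _; rewrite tensZ.
Qed.

End Resolution.

(** * Ascent and descent along localizations *)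

Lemma uniform_exponent (I : finType) (P : I -> nat -> Prop) :
  (forall i n n', (n <= n')%N -> P i n -> P i n') ->
  (forall i, exists n, P i n) -> exists n, forall i, P i n.
Proof.
move=> mono /choice[n hn]; exists (\max_i n i) => i.
by apply: mono (hn i); apply: leq_bigmax.
Qed.

(** The [A]-module underlying [B]. The morphism is a parameter of the type so
that the scalar action can be recovered from it. *)
Definition restr_along (A B : comPzRingType) (phi : {rmorphism A -> B}) : Type := B.

Section RestrictScalars.
Variables (A B : comPzRingType) (phi : {rmorphism A -> B}).

Local Notation restr := (restr_along phi).
HB.instance Definition _ := GRing.Zmodule.on restr.
Definition restr_scale (a : A) (b : restr) : restr := phi a * (b : B).
Fact restr_scaleA a b x : restr_scale a (restr_scale b x) = restr_scale (a * b) x.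
Proof. by rewrite /restr_scale rmorphM mulrA. Qed.
Fact restr_scale1 : left_id 1 restr_scale.
Proof. by move=> x; rewrite /restr_scale rmorph1 mul1r. Qed.
Fact restr_scaleDr : right_distributive restr_scale +%R.
Proof. by move=> a x y; apply: mulrDr. Qed.
Fact restr_scaleDl x : {morph restr_scale^~ x : a b / a + b}.
Proof. by move=> a b; rewrite /restr_scale rmorphD; apply: mulrDl. Qed.
HB.instance Definition _ := GRing.Zmodule_isLmodule.Build A restr
  restr_scaleA restr_scale1 restr_scaleDr restr_scaleDl.
End RestrictScalars.

Section ModuleLocalization.
Variables (A B : comPzRingType) (f : A) (phi : {rmorphism A -> B}).
Variables (M : lmodType A) (L : lmodType B) (l : M -> L).
Hypothesis lD : {morph l : x y / x + y}.
Hypothesis lZ : forall a x, l (a *: x) = phi a *: l x.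
Hypothesis philoc : is_ring_localization f phi.
Hypothesis lloc : is_module_localization f phi l.

Let l0 : l 0 = 0.
Proof. by apply: (addrI (l 0)); rewrite -lD !addr0. Qed.

Let lN x : l (- x) = - l x.
Proof. by apply: (addrI (l x)); rewrite -lD !subrr. Qed.

Let l_sum (I : Type) (s : seq I) (F : I -> M) :
  l (\sum_(i <- s) F i) = \sum_(i <- s) l (F i).
Proof. exact: (big_morph l lD l0). Qed.

Lemma loc_inv : exists u : B, forall n, u ^+ n * phi f ^+ n = 1.
Proof.
by case: philoc => -[u fu] _ _; exists u => n; rewrite -exprMn mulrC fu expr1n.
Qed.

Lemma loc_cleared (I : finType) (F : I -> B) :
  exists n (c : I -> A), forall i, phi f ^+ n * F i = phi (c i).
Proof.
case: philoc => _ surj _.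
have [|i|n hn] :=
  @uniform_exponent I (fun i n => exists a, phi f ^+ n * F i = phi a).
- move=> i n n' le [a e]; exists (f ^+ (n' - n) * a).
  by rewrite rmorphM rmorphXn -e mulrA -exprD subnK.
- by have [a [n e]] := surj (F i); exists n, a.
by have [c hc] := choice hn; exists n, c.
Qed.

Lemma modloc_cleared (I : finType) (F : I -> L) :
  exists n (c : I -> M), forall i, phi f ^+ n *: F i = l (c i).
Proof.
case: lloc => _ surj _.
have [|i|n hn] := @uniform_exponent I (fun i n => exists a, phi f ^+ n *: F i = l a).
- move=> i n n' le [a e]; exists (f ^+ (n' - n) *: a).
  by rewrite lZ rmorphXn -e scalerA -exprD subnK.
- by have [a [n e]] := surj (F i); exists n, a.
by have [c hc] := choice hn; exists n, c.
Qed.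

Lemma loc_killed (I : finType) (F : I -> A) :
  (forall i, phi (F i) = 0) -> exists n, forall i, f ^+ n * F i = 0.
Proof.
case: philoc => _ _ ker F0; apply: uniform_exponent => i.
  by move=> n n' le e; rewrite -(subnK le) exprD -mulrA e mulr0.
exact/ker/F0.
Qed.

Lemma modloc_killed (I : finType) (F : I -> M) :
  (forall i, l (F i) = 0) -> exists n, forall i, f ^+ n *: F i = 0.
Proof.
case: lloc => _ _ ker F0; apply: uniform_exponent => i.
  by move=> n n' le e; rewrite -(subnK le) exprD -scalerA e scaler0.
exact/ker/F0.
Qed.

(** Write [f^n y = l m] and resolve [m] over [A]; dividing the coefficients by
[f^n] resolves [y]. A relation of [y] becomes, up to powers of [f], a relation
of [m]. *)
Lemma locally_dual_loc : locally_dual M -> locally_dual L.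
Proof.
move=> ldM I y; have [u uE] := loc_inv.
have [n [m mE]] := modloc_cleared y.
have [K [C [x [xE C0]]]] := ldM I m.
exists K, (fun i k => u ^+ n * phi (C i k)), (fun k => l (x k)); split=> [i|r r0 k].
  rewrite -[LHS]scale1r -(uE n) -scalerA mE xE l_sum scaler_sumr.
  by apply: eq_bigr => k _; rewrite lZ scalerA.
have [p [a aE]] := loc_cleared r.
have la0 : l (\sum_i a i *: m i) = 0.
  rewrite l_sum; transitivity (phi f ^+ (p + n) *: \sum_i r i *: y i).
    rewrite scaler_sumr; apply: eq_bigr => i _.
    by rewrite lZ -aE -mE !scalerA exprD -!mulrA; congr (_ * _ *: _); rewrite mulrC.
  by rewrite r0 scaler0.
have [q hq] := modloc_killed (fun _ : 'I_1 => la0).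
have := C0 (fun i => f ^+ q * a i).
under eq_bigr do rewrite -scalerA.
rewrite -scaler_sumr (hq ord0) => /(_ erefl k) /(congr1 phi).
rewrite raddf0 raddf_sum => h.
rewrite -[LHS]mul1r -(uE (q + p)%N) -mulrA mulr_sumr.
rewrite (eq_bigr (fun i => u ^+ n * phi (f ^+ q * a i * C i k))) => [|i _].
  by rewrite -mulr_sumr h !mulr0.
rewrite !rmorphM rmorphXn /= -aE exprD !mulrA; congr (_ * _).
by rewrite [LHS]mulrC !mulrA.
Qed.

(** What remains in [M] of a resolution over the localization. The coefficients
of a relation vanish only in [B]: the power of [f] which kills them in [A]
depends on the relation. *)
Lemma loc_resolution (I : finType) (x : I -> M) :
  locally_dual L ->
  exists (P : nat) (K : finType) (c : I -> K -> A) (z : K -> M),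
    (forall i, f ^+ P *: x i = \sum_k c i k *: z k) /\
    forall r, \sum_i r i *: x i = 0 -> forall k, phi (\sum_i r i * c i k) = 0.
Proof.
move=> ldL; have [u uE] := loc_inv.
have [K [C [y [yE C0]]]] := ldL I (l \o x).
have [n [c cE]] := loc_cleared (fun p : I * K => C p.1 p.2).
have [n' [z zE]] := modloc_cleared y.
have [i|p hp] := modloc_killed
  (F := fun i => f ^+ (n + n') *: x i - \sum_k c (i, k) *: z k).
  rewrite lD lN lZ l_sum [l (x i)]yE scaler_sumr -sumrB big1 // => k _.
  by rewrite lZ -zE -cE rmorphXn !scalerA exprD /= mulrAC subrr.
exists (p + (n + n'))%N, K, (fun i k => f ^+ p * c (i, k)), z; split=> [i|r r0 k].
  have /eqP := hp i; rewrite scalerBr subr_eq0 scalerA -exprD => /eqP ->.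
  by rewrite scaler_sumr; apply: eq_bigr => k _; rewrite scalerA.
rewrite raddf_sum.
rewrite (eq_bigr (fun i => phi f ^+ (p + n) * (phi (r i) * C i k))) => [|i _].
  rewrite -mulr_sumr (C0 (fun i => phi (r i))) ?mulr0 //.
  by rewrite -[RHS]l0 -r0 l_sum; apply: eq_bigr => i _; rewrite lZ.
rewrite /= !rmorphM rmorphXn /= -cE exprD -mulrA mulrCA.
by congr (_ * _); rewrite mulrCA.
Qed.

(** Flatness removes the factor [f^P] of [loc_resolution] for all relations at
the same time: [sum_i x i (x) (phi (r i))_r] lives over a product of copies of
[B], where [f^P] can be divided out, and there it vanishes. *)
Lemma loc_resolves_modker (I : finType) (x : I -> M) :
  flat M -> locally_dual L -> resolves x (fun _ a => phi a = 0).
Proof.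
move=> flatM /(loc_resolution x)[P [K [c [z [xE c0]]]]]; have [u uE] := loc_inv.
pose Rel := {r : I -> A | \sum_i r i *: x i = 0}.
pose q i : mprod (fun _ : Rel => restr_along phi) := fun r => phi (sval r i).
pose q' i : mprod (fun _ : Rel => restr_along phi) :=
  fun r => u ^+ P * phi (sval r i).
have qE i : q i = f ^+ P *: q' i.
  apply/functional_extensionality_dep => r.
  by rewrite -[LHS]mul1r -(uE P) -rmorphXn mulrAC mulrC.
have t0 : \sum_i tens (x i) (q i) = 0.
  rewrite (eq_bigr (fun i => \sum_k tens (z k) (c i k *: q' i))) => [|i _].
    rewrite exchange_big /= big1 // => k _.
    rewrite -tens_sumr [X in tens _ X](_ : _ = 0) ?tens0r //.
    apply/functional_extensionality_dep => r; rewrite mprod_sumE.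
    transitivity (u ^+ P * phi (\sum_i sval r i * c i k)); last first.
      by rewrite (c0 _ (svalP r)) mulr0.
    rewrite rmorph_sum mulr_sumr; apply: eq_bigr => i _.
    by rewrite rmorphM mulrA; apply: mulrC.
  by rewrite qE -tensZ xE tens_suml; apply: eq_bigr => k _; rewrite tensZ.
have [H [C [y [yE C0]]]] := flat_syzygetic flatM t0.
exists H, C, y; split=> // r r0 k.
have := congr1 (fun f => f (exist _ r r0)) (C0 k); rewrite mprod_sumE => h.
by rewrite -[RHS]h raddf_sum; apply: eq_bigr => i _; rewrite /= rmorphM mulrC.
Qed.

End ModuleLocalization.

Definition localized_dual (A : comPzRingType) (M : lmodType A) (f : A) : Prop :=
  exists (B : comPzRingType) (phi : {rmorphism A -> B}) (L : lmodType B)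
    (l : M -> L),
    [/\ {morph l : x y / x + y}, forall a x, l (a *: x) = phi a *: l x,
        is_ring_localization f phi, is_module_localization f phi l
      & locally_dual L].

Section Descent.
Variables (A : comPzRingType) (M : lmodType A) (fs : seq A).
Hypothesis fs_loc : forall f, f \in fs -> localized_dual M f.
(** This says that [fs], or equivalently any family of powers of its elements,
generates the unit ideal. In this form it applies directly to the ideal of those
[a] for which a property holds after multiplication by [a]. *)
Hypothesis fs_unit : forall J : set A, ideal J ->
  (forall f, f \in fs -> exists n, J (f ^+ n)) -> J 1.

Lemma descent_equational : equational M.
Proof.
move=> I x r0.
have [e|ne] := pselect (\sum_i r0 i *: x i = 0); last first.
  by apply: resolves_self => r re i rr0; case: ne; rewrite -rr0.
pose J (a : A) := exists (K : finType) (C : I -> K -> A) (y : K -> M),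
  (forall i, a *: x i = \sum_k C i k *: y k) /\ forall k, \sum_i r0 i * C i k = 0.
(* Resolutions of r0 on a x and on b x add up to one on (a + b) x. *)
have idJ : ideal J.
  split=> [|a b [K [C [y [yE C0]]]] [L [D [z [zE D0]]]]|a b [K [C [y [yE C0]]]]].
  - exists 'I_0, (fun _ _ => 0), (fun=> 0); split=> [i|[]//].
    by rewrite scale0r big_ord0.
  - exists (K + L)%type,
      (fun i k => match k with inl k => C i k | inr l => D i l end),
      (fun k => match k with inl k => y k | inr l => z l end); split=> [i|[k|l]//=].
    by rewrite big_sumType /= scalerDl yE zE.
  - exists K, C, (fun k => a *: y k); split=> // i.
    rewrite -scalerA yE scaler_sumr; apply: eq_bigr => k _.
    by rewrite !scalerA mulrC.
have /(fs_unit idJ)[K [C [y [yE C0]]]] : forall f, f \in fs -> exists n, J (f ^+ n).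
  move=> f /fs_loc[B [phi [L [l [lD lZ rloc mloc ldL]]]]].
  have [P [K [c [z [zE c0]]]]] := loc_resolution lD lZ rloc mloc x ldL.
  have [k|n hn] := loc_killed rloc (F := fun k => \sum_i r0 i * c i k).
    exact: c0.
  exists (n + P)%N, K, (fun i k => f ^+ n * c i k), z; split=> [i|k].
    rewrite exprD -scalerA zE scaler_sumr.
    by apply: eq_bigr => k _; rewrite scalerA.
  by rewrite -[RHS](hn k) mulr_sumr; apply: eq_bigr => i _; rewrite mulrCA.
exists K, C, y; split=> [i|r _ k -> //].
by rewrite -yE scale1r.
Qed.

(** Resolutions that work modulo the kernel of each localization are composed
along the list [fs]. In the end the coefficients of all relations are killed
by a power of each [f] in [fs], hence by [1]. *)
Lemma descent_locally_dual : locally_dual M.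
Proof.
have flatM := equational_flat descent_equational.
pose S (gs : seq A) (a : A) := forall g, g \in gs -> exists n, g ^+ n * a = 0.
have idS gs : ideal (S gs).
  split=> [g _|a b ha hb g gg|a b hb g /hb[n e]].
  - by exists 0%N; rewrite mulr0.
  - have [n en] := ha g gg; have [m em] := hb g gg; exists (n + m)%N.
    by rewrite mulrDr exprD mulrAC en mul0r add0r -mulrA em mulr0.
  - by exists n; rewrite mulrCA e mulr0.
move=> I x; suff : resolves x (fun _ => S fs).
  apply: resolvesW => _ a Sa; rewrite -[LHS]mul1r.
  apply: (fs_unit (J := fun b => b * a = 0)) => //.
  split=> [|b c hb hc|b c hc]; rewrite ?mul0r // ?mulrDl ?hb ?hc ?addr0 //.
  by rewrite -mulrA hc mulr0.
have : forall f, f \in fs -> localized_dual M f by exact: fs_loc.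
elim: fs => [|f gs IH] h; first by apply: resolves_self => r _ i g.
have {}IH : resolves x (fun _ => S gs).
  by apply: IH => g gg; apply: h; rewrite inE gg orbT.
have [B [phi [L [l [lD lZ rloc mloc ldL]]]]] := h f (mem_head _ _).
apply: resolvesW (resolves_comp (T := fun _ a => phi a = 0) (fun=> idS gs) IH _)
  => [r a [Sa pa] g|K C y].
  rewrite inE => /orP[/eqP ->|/Sa//].
  by case: rloc => _ _; apply.
by apply: resolvesW (loc_resolves_modker lD lZ rloc mloc y flatM ldL) => s a pa r _.
Qed.

End Descent.

(** * Localization in stages *)

Section LocalizationTransitivity.
Variables (A B1 B2 : comPzRingType) (phi1 : {rmorphism A -> B1})
  (phi2 : {rmorphism A -> B2}) (th : {rmorphism B1 -> B2}).
Variables (N : lmodType A) (L1 : lmodType B1) (L2 : lmodType B2).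
Variables (l1 : N -> L1) (l2 : N -> L2) (j : L1 -> L2).
Hypothesis thE : forall a, th (phi1 a) = phi2 a.
Hypothesis jE : forall x, j (l1 x) = l2 x.
Hypothesis jZ : forall b y, j (b *: y) = th b *: j y.
Hypothesis l1Z : forall a x, l1 (a *: x) = phi1 a *: l1 x.

(** Since [g] is invertible on both [L1] and [L2], every question about [j] can
be multiplied by a power of [g] and moved to [N]. *)
Lemma modloc_trans (g f : A) :
  is_module_localization g phi1 l1 -> is_module_localization (g * f) phi2 l2 ->
  is_module_localization (phi1 f) th j.
Proof.
move=> [[g1 g1K1 g1K2] surj1 ker1] [[gf2 gf2K1 gf2K2] surj2 ker2].
have gI n : injective (fun y : L1 => phi1 g ^+ n *: y).
  elim: n => [|n IH] x y; first by rewrite !scale1r.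
  by rewrite !exprS -!scalerA => /(can_inj g1K1)/IH.
have gV n (y : L1) : exists x, phi1 g ^+ n *: x = y.
  elim: n y => [|n IH] y; first by exists y; rewrite scale1r.
  by have [x e] := IH y; exists (g1 x); rewrite exprSr -scalerA g1K2.
have gI2 n : injective (fun y : L2 => phi2 g ^+ n *: y).
  elim: n => [|n IH] x y; first by rewrite !scale1r.
  rewrite !exprS -!scalerA => e; apply/IH/(can_inj gf2K1).
  by rewrite /= rmorphM mulrC -!scalerA e.
split.
- rewrite thE; exists (fun y => phi2 g *: gf2 y) => y.
    apply: (can_inj gf2K1).
    by rewrite /= scalerA mulrC -scalerA gf2K2 scalerA -rmorphM.
  by rewrite scalerA mulrC -rmorphM gf2K2.
- move=> y; have [x [n e]] := surj2 y; have [x' e'] := gV n (l1 x).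
  exists x', n; apply: (gI2 n); rewrite thE /= scalerA -exprMn -rmorphM e.
  by rewrite -jE -e' jZ rmorphXn thE.
- move=> y jy0; have [x [n e]] := surj1 y.
  have /ker2[m e2] : l2 x = 0 by rewrite -jE -e jZ jy0 scaler0.
  exists m; apply: (gI (m + n)%N); rewrite /= scaler0.
  have <- : l1 ((g * f) ^+ m *: x) = 0.
    by rewrite e2 -[X in l1 X](scale0r (0 : N)) l1Z rmorph0 scale0r.
  rewrite l1Z -e !scalerA rmorphXn rmorphM exprMn exprD.
  by congr (_ *: _); rewrite mulrAC.
Qed.

End LocalizationTransitivity.

Lemma modloc_unit (A B : comPzRingType) (phi : {rmorphism A -> B})
    (N : lmodType A) (L : lmodType B) (l : N -> L) (c f : A) :
  (forall a x, l (a *: x) = phi a *: l x) ->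
  (exists b, c * b = 1) ->
  is_module_localization (c * f) phi l -> is_module_localization f phi l.
Proof.
move=> lZ [b cb] [[h hK1 hK2] surj ker].
have pcb : phi c * phi b = 1 by rewrite -rmorphM cb rmorph1.
split.
- exists (fun y => phi c *: h y) => y.
    rewrite -[RHS]scale1r -pcb -scalerA; congr (_ *: _).
    apply: (can_inj hK1); rewrite /= hK2 rmorphM !scalerA.
    by rewrite mulrAC pcb mul1r.
  by rewrite scalerA mulrC -rmorphM hK2.
- move=> y; have [x [n e]] := surj y; exists (b ^+ n *: x), n.
  rewrite lZ -e scalerA rmorphXn -exprMn rmorphM mulrA [_ * phi c]mulrC pcb.
  by rewrite mul1r.
- move=> x /ker[n e]; exists n.
  by rewrite -[f]mul1r -cb mulrAC [_ * b]mulrC exprMn -scalerA e scaler0.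
Qed.

(** * Loci of invertibility *)

Section Loci.
Variables (X : topologicalType) (O : ring_sheaf X).
Implicit Types U W : opens X.

(** For an affine [U] this is the basic open set [D(s)], described without
reference to a chart; it is compatible with restriction. *)
Definition unit_locus U (s : O U) : set X :=
  [set x | exists (W : opens X) (WU : W `<=` U),
     (W : set X) x /\ exists b, rres O WU s * b = 1].

Lemma unit_locus_sub U (s : O U) : unit_locus s `<=` U.
Proof. by move=> x [W [WU [Wx _]]]; apply: WU. Qed.

Lemma unit_locus_open U (s : O U) : open (unit_locus s).
Proof.
have -> : unit_locus s = \bigcup_(W in [set W : opens X |
    exists WU : W `<=` U, exists b, rres O WU s * b = 1]) (W : set X).
  apply/seteqP; split=> x.
    by move=> [W [WU [Wx b]]]; exists W => //; exists WU.
  by move=> [W [WU b] Wx]; exists W, WU.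
by apply: bigcup_open => W _; apply: opens_open.
Qed.

Definition unit_open U (s : O U) : opens X := Opens (unit_locus_open s).

Lemma unit_locus_rres U W (WU : W `<=` U) (s : O U) :
  unit_locus (rres O WU s) = unit_locus s `&` W.
Proof.
apply/seteqP; split=> x.
  move=> [V [VW [Vx [b e]]]]; split; last exact: (VW x Vx).
  exists V, (subset_trans VW WU); split=> //; exists b.
  by rewrite -(rres_comp VW WU).
move=> [[V [VU [Vx [b e]]]] Wx].
exists (opensI V W), (@subIsetr _ _ _); split => //.
exists (rres O (@subIsetl _ V W : opensI V W `<=` V) b).
rewrite (rres_comp _ _ (subset_trans (@subIsetl _ V W) VU : opensI V W `<=` U)).
rewrite -(rres_comp (@subIsetl _ V W : opensI V W `<=` V) VU).
by rewrite -rmorphM e rmorph1.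
Qed.

Lemma unit_locus1 U : unit_locus (1 : O U) = U.
Proof.
apply/seteqP; split; first exact: unit_locus_sub.
move=> x Ux; exists U, (fun _ h => h); split=> //.
by exists 1; rewrite rmorph1 mulr1.
Qed.

Lemma unit_locus_mul U (s t : O U) :
  unit_locus (s * t) = unit_locus s `&` unit_locus t.
Proof.
apply/seteqP; split=> x.
  move=> [V [VU [Vx [b]]]]; rewrite rmorphM => e.
  split; exists V, VU; split=> //.
    by exists (rres O VU t * b); rewrite mulrA.
  by exists (rres O VU s * b); rewrite mulrCA mulrA.
move=> [[V [VU [Vx [b e]]]] [W [WU [Wx [c e']]]]].
pose VW := opensI V W.
have VWV : VW `<=` V by exact: subIsetl.
have VWW : VW `<=` W by exact: subIsetr.
have VWU : VW `<=` U := subset_trans VWV VU.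
exists VW, VWU; split => //; exists (rres O VWV b * rres O VWW c).
rewrite rmorphM mulrACA -{1}(rres_comp VWV VU) -(rres_comp VWW WU).
by rewrite -!rmorphM e e' !rmorph1 mulr1.
Qed.

Lemma unit_locus_unit U (c b : O U) : c * b = 1 -> unit_locus c = U.
Proof.
move=> cb; apply/seteqP; split; first exact: unit_locus_sub.
move=> x Ux; exists U, (fun _ h => h); split=> //; exists (rres O (fun _ h => h) b).
by rewrite -rmorphM cb rmorph1.
Qed.

End Loci.

(** * Affine open sets *)

Lemma ideal_adjoin (A : comPzRingType) (J : set A) (x : A) :
  ideal J -> ideal [set z | exists j a, J j /\ z = j + a * x].
Proof.
case=> J0 JD JM; split.
- by exists 0, 0; rewrite mul0r addr0.
- move=> _ _ [j [a [Jj ->]]] [k [b [Jk ->]]]; exists (j + k), (a + b).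
  by split; [exact: JD | rewrite mulrDl addrACA].
- move=> c _ [j [a [Jj ->]]]; exists (c * j), (c * a).
  by split; [exact: JM | rewrite mulrDr mulrA].
Qed.

(** Zorn is applied to the sets [Y] such that [Y `|` I] is a proper ideal: in
this way the empty chain causes no trouble, its union giving [I] itself. *)
Lemma exists_prime (A : comPzRingType) (I : set A) :
  ideal I -> ~ I 1 -> exists p, prime_ideal p /\ I `<=` p.
Proof.
move=> idI nI1; pose P (Y : set A) := ideal (Y `|` I) /\ ~ (Y `|` I) 1.
have [F FP Ftot|Y [[idJ nJ1] Ymax]] := @Zorn_bigcup A P.
  split; last first.
    move=> [[Y FY Y1]|//]; by have [_] := FP _ FY; apply; left.
  case: idI => I0 ID IM; split; first by right.
  - have aux (a b : A) Y : F Y -> (Y `|` I) a -> (Y `|` I) b ->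
        (\bigcup_(X in F) X `|` I) (a + b).
      move=> FY Ya Yb; have [[_ YD _] _] := FP _ FY.
      by case: (YD a b Ya Yb) => [Yab|]; [left; exists Y|right].
    move=> a b [[Y FY Ya]|Ia] [[Z FZ Zb]|Ib].
    + case: (Ftot _ _ FY FZ) => [YZ|ZY].
        by apply: (aux _ _ Z) => //; left => //; apply: YZ.
      by apply: (aux _ _ Y) => //; left => //; apply: ZY.
    + by apply: (aux _ _ Y) => //; [left|right].
    + by apply: (aux _ _ Z) => //; [right|left].
    + by right; apply: ID.
  - move=> a b [[Y FY Yb]|Ib]; last by right; apply: IM.
    have [[_ _ YM] _] := FP _ FY.
    by case: (YM a b (or_introl Yb)) => [Yab|]; [left; exists Y|right].
set J := Y `|` I in idJ nJ1.
have out x : ~ J x -> exists j a, J j /\ 1 = j + a * x.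
  move=> nJx; apply: contrapT => n1.
  set K := [set z | exists j a, J j /\ z = j + a * x].
  have idK : ideal K by apply: ideal_adjoin.
  have JK : J `<=` K by move=> j Jj; exists j, 0; rewrite mul0r addr0.
  have KIK : K `|` I = K by apply: setUidl => i Ii; apply: JK; right.
  apply: (Ymax K); last by split; rewrite KIK.
  split; first by move=> y Yy; apply: JK; left.
  move=> KY; apply: nJx; left; apply: KY; exists 0, 1.
  by rewrite mul1r add0r; split=> //; apply: ideal0.
exists J; split; last by move=> i Ii; right.
case: (idJ) => J0 JD JM; split=> // x y Jxy.
apply: contrapT => /not_orP[/out[j [a [Jj e]]] /out[k [b [Jk e']]]].
apply: nJ1; rewrite -[1]mulr1 [X in X * _]e [X in _ * X]e' mulrDl !mulrDr.
apply: (JD); apply: (JD); rewrite ?[j * _]mulrC; do ?exact: JM.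
by rewrite mulrACA; apply: JM.
Qed.

Section Affine.
Variables (X : topologicalType) (O : ring_sheaf X).

(** The facts about an affine open set that the rest of the proof needs, with
all mention of the chart removed: localization over basic open sets, basic
open sets as a basis of the topology, locality of the stalks, and the
Nullstellensatz-like statement that an ideal without common zeros is the unit
ideal. *)
Record affine_like (U : opens X) : Prop := AffineLike {
  af_loc : forall (s : O U) (W : opens X) (WU : W `<=` U),
    W = unit_locus s :> set X -> is_ring_localization s (rres O WU);
  af_basis : forall (W : opens X) x, W `<=` U -> (W : set X) x ->
    exists s : O U, unit_locus s x /\ unit_locus s `<=` W;
  af_local : forall x, (U : set X) x -> ideal [set s : O U | ~ unit_locus s x];
  af_unit : forall J : set (O U), ideal J ->
    (forall x, (U : set X) x -> exists s n, unit_locus s x /\ J (s ^+ n)) -> J 1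
}.

Section Chart.
Variables (U : opens X) (A : comPzRingType) (psi : Spec A -> X)
  (iota : {rmorphism A -> O U}).
Hypothesis chart : affine_chart psi iota.

Lemma zariski_open_basic (a : A) : zariski_open (basic_open a).
Proof. by exists [set a]. Qed.

Lemma open_basic (a : A) : open (basic_open a).
Proof.
rewrite openE => p pa; exists (basic_open a); split=> //.
exact: zariski_open_basic.
Qed.

Lemma basic_openP (a : A) p : basic_open a p <-> ~ spec_ideal p a.
Proof.
split=> [h pa|h /(_ a erefl)//]; by apply: h => _ ->.
Qed.

Lemma basic_open1 : basic_open (1 : A) = setT.
Proof.
apply/seteqP; split=> // p _; apply/basic_openP.
by case: (spec_prime p).
Qed.

Lemma chart_mem p : (U : set X) (psi p).
Proof. by rewrite -(chart_range chart); exists p. Qed.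

Lemma chart_surj s : exists a, iota a = s.
Proof.
have UU : U `<=` U by [].
have [|_ surj _] := @chart_loc _ _ _ _ _ _ chart 1 U UU.
  by rewrite basic_open1 (chart_range chart).
have [a [n]] := surj s; rewrite /= rmorph1 rmorph1 expr1n mul1r rres_id => ->.
by exists a.
Qed.

Lemma chart_basis (W : opens X) p : (W : set X) (psi p) ->
  exists c, ~ spec_ideal p c /\ psi @` basic_open c `<=` W.
Proof.
move=> Wp; have /(chart_continuous chart)[B [[E BE] Bp BW]] : nbhs (psi p) W.
  by apply: open_nbhs_nbhs; split=> //; apply: opens_open.
have [c [Ec npc]] : exists c, E c /\ ~ spec_ideal p c.
  apply: contrapT => h; move: Bp; rewrite BE; apply => c Ec.
  by apply: contrapT => npc; apply: h; exists c.
exists c; split=> // _ [q /basic_openP qc <-]; apply: BW; rewrite BE => h.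
by apply: qc; apply: h.
Qed.

Lemma prime_exp (p : set A) a n : prime_ideal p -> p (a ^+ n) -> p a.
Proof.
case=> _ _ _ p1 pM; elim: n => [|n IH]; first by rewrite expr0.
by rewrite exprS => /pM[].
Qed.

(** A section [a] is invertible on [D(a)]. Conversely, if [a] becomes
invertible on a neighbourhood [D(c)] of [p], then a power of [c] is a multiple
of [a], so [a] is not in [p] when [c] is not. *)
Lemma chart_invl a : psi @` basic_open a = unit_locus (iota a).
Proof.
have sub b : psi @` basic_open b `<=` U by move=> _ [p _ <-]; apply: chart_mem.
pose D b := Opens (chart_open chart (open_basic b)).
apply/seteqP; split=> x.
  move=> ax; exists (D a), (sub a); split=> //.
  by have [] := @chart_loc _ _ _ _ _ _ chart a (D a) (sub a) erefl.
move=> /[dup]/unit_locus_sub; rewrite -(chart_range chart) => -[p _ <-].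
move=> [W [WU [Wp [b e]]]]; exists p => //; apply/basic_openP => pa.
have [c [npc cW]] : exists c, ~ spec_ideal p c /\ D c `<=` W.
  exact: chart_basis.
have [[b' e'] surj ker] := @chart_loc _ _ _ _ _ _ chart c (D c) (sub c) erefl.
have [d [n dE]] := surj (rres O cW b).
have /ker[m] : (rres O (sub c : D c `<=` U) \o iota) (a * d - c ^+ n) = 0.
  rewrite /= !rmorphB !rmorphM !rmorphXn /= -[rres O _ (iota d)]dE /=.
  rewrite mulrCA -(rres_comp cW WU (sub c) (iota a)) -rmorphM e rmorph1 mulr1.
  by rewrite subrr.
move=> /eqP; rewrite mulrBr subr_eq0 -exprD => /eqP acE.
case: (spec_prime p) => _ _ pM _ _; apply: npc.
apply: (prime_exp (spec_prime p) (n := (m + n)%N)).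
by rewrite -acE mulrA; rewrite mulrC mulrA; apply: pM.
Qed.

Lemma chart_in_invl a p : unit_locus (iota a) (psi p) <-> ~ spec_ideal p a.
Proof.
rewrite -chart_invl -basic_openP; split=> [[q qa /(chart_inj chart) <-]//|pa].
by exists p.
Qed.

Lemma chart_affine_like : affine_like U.
Proof.
split.
- move=> s W WU; have [a <-] := chart_surj s; rewrite -chart_invl => WE.
  have [unit surj ker] := @chart_loc _ _ _ _ _ _ chart a W WU WE.
  split=> // [b|t]; first by have [c [n e]] := surj b; exists (iota c), n.
  have [c <-] := chart_surj t => /ker[n e]; exists n.
  by rewrite -rmorphXn -rmorphM e rmorph0.
- move=> W x WU Wx; have := WU x Wx; rewrite -(chart_range chart) => -[p _ px].
  have [c [npc cW]] : exists c, ~ spec_ideal p c /\ psi @` basic_open c `<=` W.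
    by apply: chart_basis; rewrite px.
  by exists (iota c); rewrite -px -chart_invl; split=> //; rewrite chart_invl;
    apply/chart_in_invl.
- move=> x; rewrite -(chart_range chart) => -[p _ <-].
  case: (spec_prime p) => p0 pD pM _ _; split.
  + by rewrite -(rmorph0 iota) => /chart_in_invl; apply.
  + move=> s t; have [a <-] := chart_surj s; have [b <-] := chart_surj t.
    move=> /chart_in_invl/contrapT pa /chart_in_invl/contrapT pb.
    by rewrite /= -rmorphD; apply/chart_in_invl => n; apply/n/pD.
  + by move=> a b /= nb; rewrite unit_locus_mul => -[_ /nb].
- move=> J idJ hJ; apply: contrapT => nJ1.
  have [||p [pp Jp]] := @exists_prime A (iota @^-1` J).
  + case: idJ => J0 JD JM; split=> [|a b|a b] /=.
    * by rewrite rmorph0.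
    * by rewrite rmorphD; apply: JD.
    * by rewrite rmorphM; apply: JM.
  + by rewrite /= rmorph1.
  have [s [n [sp Jsn]]] := hJ _ (chart_mem (SpecPoint pp)).
  have [a aE] := chart_surj s; rewrite -aE in sp Jsn.
  move/chart_in_invl: sp; apply; apply: (prime_exp (n := n) pp).
  by apply: Jp; rewrite /= rmorphXn.
Qed.

End Chart.

Lemma affine_open_like U : affine_open O U -> affine_like U.
Proof. by move=> [A [psi [iota h]]]; apply: chart_affine_like h. Qed.

Section AffineLike.
Variable U : opens X.
Hypothesis afU : affine_like U.

Lemma af_cover_unit (E J : set (O U)) : ideal J ->
  U `<=` \bigcup_(s in E) unit_locus s ->
  (forall s, E s -> exists n, J (s ^+ n)) -> J 1.
Proof.
move=> idJ cov h; apply: (af_unit afU) => // x /cov[s Es sx].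
by have [n Jn] := h s Es; exists s, n.
Qed.

(** The elements that lie in the ideal generated by finitely many members of [E]
form an ideal, which is the unit ideal because [E] covers [U]. *)
Lemma af_quasi_compact (E : set (O U)) : U `<=` \bigcup_(s in E) unit_locus s ->
  exists l : seq (O U), (forall s, s \in l -> E s) /\
    U `<=` \bigcup_(s in [set` l]) unit_locus s.
Proof.
move=> cov.
pose J (b : O U) := exists l : seq (O U), (forall s, s \in l -> E s) /\
  forall K : set (O U), ideal K -> (forall s, s \in l -> K s) -> K b.
have [||l [lE h]] := @af_cover_unit E J _ cov.
- split=> [|a b [l [lE hl]] [k [kE hk]]|a b [l [lE hl]]].
  + by exists [::]; split=> // K [].
  + exists (l ++ k); split=> [s|K idK h].
      by rewrite mem_cat => /orP[/lE|/kE].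
    apply: (idealD idK); [apply: hl|apply: hk] => // s sl; apply: h;
      by rewrite mem_cat sl ?orbT.
  + exists l; split=> // K idK h; apply: (idealM idK); exact: hl.
- move=> s Es; exists 1%N, [:: s]; rewrite expr1; split=> [t|K _].
    by rewrite inE => /eqP ->.
  by apply; rewrite inE.
exists l; split=> // x Ux; apply: contrapT => nx.
have := h _ (af_local afU Ux); apply; last by rewrite unit_locus1.
by move=> s sl sx; apply: nx; exists s.
Qed.

End AffineLike.

(** Take [D(t)] in [V] inside the intersection, then [D(s)] in [U] inside
[D(t)]. The restriction of [s] to [D(t)] is a fraction [a / t^n], so that
[D(s) = D(a t)]. *)
Lemma common_basic U V x : affine_like U -> affine_like V ->
  (U : set X) x -> (V : set X) x ->
  exists (s : O U) (t : O V), unit_locus s x /\ unit_locus s = unit_locus t.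
Proof.
move=> afU afV Ux Vx.
have [t [tx tU]] := af_basis afV (@subIsetr _ U V : opensI U V `<=` V) (conj Ux Vx).
pose W := unit_open t.
have WU : W `<=` U by move=> y /tU[].
have WV : W `<=` V by apply: unit_locus_sub.
have [s [sx sW]] := af_basis afU WU tx.
have [[b tb] surj _] := af_loc afV WV (erefl : W = unit_locus t :> set X).
have [a [n e]] := surj (rres O WU s).
exists s, (a * t); split=> //; rewrite unit_locus_mul.
have tn : rres O WV t ^+ n * b ^+ n = 1 by rewrite -exprMn tb expr1n.
have -> : unit_locus s = unit_locus (rres O WU s).
  by rewrite unit_locus_rres; apply/esym/setIidl.
rewrite -(unit_locus_rres WV) -e unit_locus_mul (unit_locus_unit tn).
apply/esym/setIidr.
exact: unit_locus_sub.
Qed.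

End Affine.

(** * Quasi-coherent sheaves on affine open sets *)

Section ModuleSheaf.
Variables (X : topologicalType) (O : ring_sheaf X) (M : module_sheaf O).
Implicit Types U V W : opens X.

Lemma mresZ U V (UV : U `<=` V) a x :
  mres M UV (a *: x) = rres O UV a *: mres M UV x.
Proof. exact: linearZ. Qed.

Lemma msec_separated (I : Type) (W : I -> opens X) U (WU : forall i, W i `<=` U)
    (x y : M U) :
  U `<=` \bigcup_i W i -> (forall i, mres M (WU i) x = mres M (WU i) y) -> x = y.
Proof.
move=> cov xy.
have [|z [_ zU]] := @msec_sheaf _ _ M I W U WU (fun i => mres M (WU i) x) cov.
  move=> i j; have WWU : opensI (W i) (W j) `<=` U by move=> z [/WU].
  by rewrite !(mres_comp _ _ WWU).
by rewrite -(zU x) //; apply: zU => i; rewrite xy.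
Qed.

Definition mod_localizes U : Prop :=
  forall (s : O U) (W : opens X) (WU : W `<=` U), W = unit_locus s :> set X ->
    is_module_localization s (rres O WU) (mres M WU).

(** Localization over the basic open set [W = D(s)] of [U], tested only on
sections [k] that extend to [U]. *)
Definition mod_localizes_on U (s : O U) : Prop :=
  forall (k : O U) (W W' : opens X) (WU : W `<=` U) (W'W : W' `<=` W),
    W = unit_locus s :> set X -> W' = unit_locus s `&` unit_locus k :> set X ->
    is_module_localization (rres O WU k) (rres O W'W) (mres M W'W).

(** The restriction of [k] to [D(s) = D(t)] is a fraction [a / t^n] with [a] in
[O V], so that [D(s) `&` D(k) = D(t a)]: the claim is localization in stages
from [M V], up to the unit [t^n]. *)
Lemma mod_localizes_common U V (s : O U) (t : O V) :
  affine_like O V -> mod_localizes V -> unit_locus s = unit_locus t ->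
  mod_localizes_on s.
Proof.
move=> afV nV st k W W' WU W'W Ws W's.
have WV : W `<=` V by rewrite Ws st; apply: unit_locus_sub.
have Wt : W = unit_locus t :> set X by rewrite Ws.
have [[b tb] surj _] := af_loc afV WV Wt.
have [a [n e]] := surj (rres O WU k).
have tn : rres O WV t ^+ n * b ^+ n = 1 by rewrite -exprMn tb expr1n.
have W't : W' = unit_locus (t * a) :> set X.
  rewrite W's -Ws unit_locus_mul -Wt setIC -(unit_locus_rres WU) [RHS]setIC.
  rewrite -(unit_locus_rres WV) -e.
  by rewrite unit_locus_mul (unit_locus_unit tn); apply/esym/setIidr/unit_locus_sub.
apply: (@modloc_unit _ _ _ _ _ _ (rres O WV t ^+ n)); first exact: mresZ.
  by exists (b ^+ n).
rewrite e.
apply: (modloc_trans (phi1 := rres O WV) (phi2 := rres O (subset_trans W'W WV))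
  (l1 := mres M WV) (l2 := mres M (subset_trans W'W WV)) _ _ _ _ (g := t)).
- by move=> c; apply: rres_comp.
- by move=> x; apply: mres_comp.
- exact: mresZ.
- exact: mresZ.
- exact: nV.
- exact: nV.
Qed.

(** Take a finite cover of [U] by basic open sets [W i] on which [M] is known to
localize. A section which vanishes on [D(f)] is killed by a power of [f] on
each [W i], hence on [U]. A section [y] over [D(f)] extends to each [W i] after
multiplication by a power of [f]; two such extensions agree over
[D(f) `&` W i `&` W j], hence agree on [W i `&` W j] after multiplication by a
further power of [f], and then they glue. *)
Lemma mod_localizes_cover U : affine_like O U ->
  U `<=` \bigcup_(s in @mod_localizes_on U) unit_locus s -> mod_localizes U.
Proof.
move=> afU /(af_quasi_compact afU)[l [lE cov]] f Wf WfU WfE.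
pose W (i : seq_sub l) := unit_open (val i).
have WU i : W i `<=` U by apply: unit_locus_sub.
have {}cov : U `<=` \bigcup_i W i.
  by move=> x /cov[s sl sx]; exists (SeqSub sl).
pose V i := opensI (W i) Wf.
have VW i : V i `<=` W i by apply: subIsetl.
have Vf i : V i `<=` Wf by apply: subIsetr.
have VU i : V i `<=` U by apply: subset_trans (WU i).
have covf : Wf `<=` \bigcup_i V i.
  by move=> x Wx; have [i _ Wi] := cov x (WfU x Wx); exists i.
have loc i :
    is_module_localization (rres O (WU i) f) (rres O (VW i)) (mres M (VW i)).
  by apply: (lE _ (valP i)) => //=; rewrite WfE.
split.
- have [[b fb] _ _] := af_loc afU WfU WfE.
  by exists ( *:%R b) => y; rewrite scalerA ?fb 1?mulrC ?fb scale1r.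
- move=> y.
  pose P i n := exists x : M (W i),
    rres O (VU i) f ^+ n *: mres M (Vf i) y = mres M (VW i) x.
  have [i n n' le [x e]|i|n hn] := @uniform_exponent _ P.
  + exists (rres O (WU i) f ^+ (n' - n) *: x).
    by rewrite mresZ -e rmorphXn scalerA (rres_comp _ _ (VU i)) -exprD subnK.
  + have [_ surj _] := loc i; have [x [n e]] := surj (mres M (Vf i) y).
    by exists n, x; rewrite -e (rres_comp _ _ (VU i)).
  pose s i := sval (cid (hn i)).
  have sE i : rres O (VU i) f ^+ n *: mres M (Vf i) y = mres M (VW i) (s i).
    exact: svalP (cid (hn i)).
  pose WW i j := opensI (W i) (W j).
  pose WWl i j : WW i j `<=` W i := @subIsetl _ (W i) (W j).
  pose WWr i j : WW i j `<=` W j := @subIsetr _ (W i) (W j).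
  have WWU i j : WW i j `<=` U := subset_trans (WWl i j) (WU i).
  pose d i j := mres M (WWl i j) (s i) - mres M (WWr i j) (s j).
  pose Q (p : seq_sub l * seq_sub l) m :=
    rres O (WWU p.1 p.2) f ^+ m *: d p.1 p.2 = 0.
  have [p m m' le e|[i j]|m hm] := @uniform_exponent _ Q.
  + by rewrite /Q -(subnK le) exprD -scalerA e scaler0.
  + pose VV := opensI (WW i j) Wf.
    have VVW : VV `<=` WW i j by apply: subIsetl.
    have VVi : VV `<=` V i by move=> x [[]].
    have VVj : VV `<=` V j by move=> x [[]].
    have VVf : VV `<=` Wf by move=> x [].
    have VVU : VV `<=` U := subset_trans VVf WfU.
    have VVWi : VV `<=` W i := subset_trans VVW (WWl i j).
    (* M(Wi n Wj n D(f)) is M(Wi n Wj)_f, by localization in stages from W i. *)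
    have locij : is_module_localization (rres O (WWl i j) (rres O (WU i) f))
        (rres O VVW) (mres M VVW).
      apply: (modloc_trans (phi1 := rres O (WWl i j)) (phi2 := rres O VVWi)
        (l1 := mres M (WWl i j)) (l2 := mres M VVWi)
        _ _ _ _ (g := rres O (WU i) (val j))).
      - by move=> c; apply: rres_comp.
      - by move=> x; apply: mres_comp.
      - exact: mresZ.
      - exact: mresZ.
      - exact: (lE _ (valP i)).
      - rewrite -rmorphM; apply: (lE _ (valP i)) => //=.
        by rewrite unit_locus_mul WfE setIA.
    have [_ _ ker] := locij.
    have dV k (VVk : VV `<=` V k) (WWk : WW i j `<=` W k) :
        mres M VVW (mres M WWk (s k)) = rres O VVU f ^+ n *: mres M VVf y.
      rewrite (mres_comp _ _ (subset_trans VVk (VW k))) -(mres_comp VVk (VW k)).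
      rewrite -sE mresZ rmorphXn (rres_comp _ _ VVU).
      by rewrite (mres_comp _ _ VVf).
    have /ker[m e] : mres M VVW (d i j) = 0.
      by rewrite /d raddfB /= (dV i VVi) (dV j VVj) subrr.
    by exists m; rewrite /Q -e (rres_comp _ _ (WWU i j)).
  have [i j|x [xE _]] := @msec_sheaf _ _ M _ W U WU
      (fun i => rres O (WU i) f ^+ m *: s i) cov.
    apply/eqP; rewrite -subr_eq0 !mresZ !rmorphXn !(rres_comp _ _ (WWU i j)).
    by rewrite -scalerBr; apply/eqP; apply: (hm (i, j)).
  exists x, (n + m)%N; apply: (msec_separated (W := V) (WU := Vf)) => // i.
  rewrite (mres_comp _ _ (VU i)) -(mres_comp (VW i) (WU i)) xE !mresZ !rmorphXn.
  by rewrite !(rres_comp _ _ (VU i)) -sE scalerA -exprD addnC.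
- move=> x x0.
  pose P i n := rres O (WU i) f ^+ n *: mres M (WU i) x = 0.
  have [i n n' le e|i|n hn] := @uniform_exponent _ P.
  + by rewrite /P -(subnK le) exprD -scalerA e scaler0.
  + have [_ _ ker] := loc i; apply: ker.
    by rewrite (mres_comp _ _ (VU i)) -(mres_comp (Vf i) WfU) x0 raddf0.
  exists n; apply: (msec_separated (WU := WU)) => // i.
  by rewrite mresZ rmorphXn hn raddf0.
Qed.

End ModuleSheaf.

Section Scheme.
Variables (X : scheme) (M : module_sheaf (scheme_sheaf X)).
Local Notation O := (scheme_sheaf X).

(** Sections over [U] itself are given by [f = 1], so that [iota] and [nu] are
surjective and statements about [A] and [N] turn into statements about [O U]
and [M U]. *)
Lemma qcoh_nbhd (x : X) : quasi_coherent M ->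
  exists U : opens X, [/\ (U : set X) x, affine_like O U & mod_localizes M U].
Proof.
move=> /(_ x)[U [Ux [A [psi [iota [chart [N [nu nuloc]]]]]]]].
exists U; split=> //; first exact: chart_affine_like chart.
have nu_surj y : exists z, nu z = y.
  have UU : U `<=` U by [].
  have [|_ surj _] := nuloc 1 U UU; first by rewrite basic_open1 (chart_range chart).
  have [z [n]] := surj y.
  by rewrite /= rmorph1 rmorph1 expr1n scale1r mres_id => ->; exists z.
move=> s W WU; have [a <-] := chart_surj chart s; rewrite -(chart_invl chart) => WE.
have [bij surj ker] := nuloc a W WU WE.
split=> // [y|y]; first by have [z [n e]] := surj y; exists (nu z), n.
have [z <-] := nu_surj y => /ker[n e]; exists n.
have nuZ b w : nu (b *: w) = iota b *: nu w by exact: linearZ.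
by rewrite -rmorphXn -nuZ e raddf0.
Qed.

Lemma qcoh_affine U : quasi_coherent M -> affine_like O U -> mod_localizes M U.
Proof.
move=> qcM afU; apply: mod_localizes_cover => // x Ux.
have [V [Vx afV nV]] := qcoh_nbhd x qcM.
have [s [t [sx st]]] := common_basic afU afV Ux Vx.
by exists s => //; apply: mod_localizes_common st.
Qed.

End Scheme.

(** * Zariski locality *)

Theorem theorem4p1 (X : scheme) (V : set (opens X))
    (V_affine : forall v : opens X, V v -> affine_open (scheme_sheaf X) v)
    (V_cover : \bigcup_(v in V) (v : set X) = [set: X])
    (M : module_sheaf (scheme_sheaf X)) (M_qcoh : quasi_coherent M)
    (M_fproj : forall v : opens X, V v -> f_projective (M v)) :
  locally_f_projective M.
Proof.
move=> u /affine_open_like afu; have nu := qcoh_affine M_qcoh afu.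
apply: locally_dual_f_projective.
have cov : u `<=` \bigcup_(s in localized_dual (M u)) unit_locus s.
  move=> x ux; have [v Vv vx] : (\bigcup_(v in V) (v : set X)) x by rewrite V_cover.
  have afv := affine_open_like (V_affine v Vv); have nv := qcoh_affine M_qcoh afv.
  have [s [t [sx st]]] := common_basic afu afv ux vx.
  have Wu : unit_open s `<=` u by apply: unit_locus_sub.
  have Wv : unit_open s `<=` v by rewrite /= st; apply: unit_locus_sub.
  exists s => //; exists _, (rres _ Wu), (M (unit_open s)), (mres M Wu); split.
  - exact: raddfD.
  - exact: mresZ.
  - exact: (af_loc afu).
  - exact: nu.
  - apply: (locally_dual_loc (l := mres M Wv) _ _ (af_loc afv Wv st) (nv _ _ Wv st)).
    + exact: raddfD.
    + exact: mresZ.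
    + exact/f_projective_locally_dual/M_fproj.
have [fs [fsE fscov]] := af_quasi_compact afu cov.
apply: (descent_locally_dual fsE) => J idJ hJ.
exact: (af_cover_unit afu idJ fscov).
Qed.
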